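(* Let $G$ be a Tambara finite group, $X$ a finite $G$-set, and $T$ a $G$-Tambara functor which is levelwise Noetherian and relatively finite-dimensional. Then $T[X]=T\boxtimes\mathbb{A}[X]$ is also levelwise Noetherian and relatively finite-dimensional. If moreover $T$ is levelwise finitely generated, then so is $T[X]$.
   Context: Let $G$ be a finite group. The category $\mathcal{P}_G$ of bispans (polynomials) has finite $G$-sets as objects; a morphism $X\to Y$ is an isomorphism class of diagrams $[X\xleftarrow{p}A\xrightarrow{q}B\xrightarrow{r}Y]$ of finite $G$-sets (isomorphisms are pairs $A\cong A'$, $B\cong B'$ compatible with all maps and the identity on $X,Y$). The composite of $[X\leftarrow A\to B\xrightarrow{r}Y]$ followed by $[Y\xleftarrow{p'}A'\xrightarrow{q'}B'\to Z]$ is $[X\leftarrow A''\to B''\to Z]$ with $B''=\{(b',s): b'\in B',\ s:q'^{-1}(b')\to B,\ r s=p'\}$, $W=B''\times_{B'}A'$, $W\to B$ given by $(a',s)\mapsto s(a')$, and $A''=W\times_B A$. A $G$-Tambara functor is a product-preserving functor $\mathcal{P}_G\to\mathrm{Set}$ (products in $\mathcal{P}_G$ are disjoint unions) whose values, which are canonically commutative semirings, are rings. For $H\leq K\leq G$ with projection $\pi:G/H\to G/K$, $\mathrm{Res}_H^K$ is induced by $[G/K\xleftarrow{\pi}G/H\xrightarrow{1}G/H\xrightarrow{1}G/H]$. For a finite $G$-set $X$, $\mathbb{A}[X]$ is the levelwise group completion of the representable functor $\mathcal{P}_G(X,-)$, where $\mathcal{P}_G(X,Y)$ is a semiring with addition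 given by disjoint union of $A$'s and of $B$'s and multiplication $[X\leftarrow A\to B\to Y]\cdot[X\leftarrow A'\to B'\to Y]=[X\leftarrow (A\times_Y B')\sqcup(A'\times_Y B)\to B\times_Y B'\to Y]$. The box product $\boxtimes$ is Day convolution of the underlying Mackey functors, and for Tambara functors it is the coproduct in the category of Tambara functors. $G$ is Tambara finite if $\mathbb{A}[X](G/L)$ is a finitely generated $\mathbb{Z}$-algebra for all finite $G$-sets $X$ and all $L\leq G$. A Tambara functor $T$ is: levelwise Noetherian if each $T(G/L)$ is a Noetherian ring; levelwise finitely generated if each $T(G/L)$ is a finitely generated $\mathbb{Z}$-algebra; relatively finite-dimensional if for all $H\leq K\leq G$ the ring map $\mathrm{Res}_H^K:T(G/K)\to T(G/H)$ is finite (the target is a finitely generated module over the source). *)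

(* Defs.v *)
From HB Require Import structures.
From mathcomp Require Import all_boot all_order all_algebra all_fingroup.

Set Implicit Arguments.
Unset Strict Implicit.
Unset Printing Implicit Defensive.

Import GroupScope GRing.Theory.
Local Open Scope ring_scope.

(** * Finite G-sets

   The group G is the whole of [gT].  As everywhere in MathComp, groups act on
   the right; a left G-set is the same thing via [g . x = x g^-1]. *)

Record gset (gT : finGroupType) := GSet {
  gset_sort :> finType;
  gset_act : {action gT &-> gset_sort} }.

Definition gact (gT : finGroupType) (X : gset gT) (x : X) (g : gT) : X :=
  gset_act X x g.
Notation "x *^ g" := (gact x g) (at level 40, left associativity).

Lemma gact1 (gT : finGroupType) (X : gset gT) (x : X) : x *^ 1%g = x.
Proof. exact: act1. Qed.

Lemma gactM (gT : finGroupType) (X : gset gT) (x : X) (g h : gT) :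
  x *^ (g * h)%g = x *^ g *^ h.
Proof. exact: actM. Qed.

Definition gset_of (gT : finGroupType) (T : finType) (a : T -> gT -> T)
    (a1 : a^~ 1%g =1 id) (aM : forall x, act_morph a x) : gset gT :=
  GSet (TotalAction a1 aM).

Record gmap (gT : finGroupType) (X Y : gset gT) := GMap {
  gmap_fun :> X -> Y;
  gmapJ : forall x g, gmap_fun (x *^ g) = gmap_fun x *^ g }.

Definition gid (gT : finGroupType) (X : gset gT) : gmap X X :=
  @GMap gT X X id (fun _ _ => erefl).

Definition gcomp (gT : finGroupType) (X Y Z : gset gT)
  (f : gmap Y Z) (e : gmap X Y) : gmap X Z.
Proof. by exists (f \o e) => x g /=; rewrite !gmapJ. Defined.

Section Subsets.
Variables (gT : finGroupType) (X : gset gT) (P : pred X).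
Hypothesis PJ : forall x g, P x -> P (x *^ g).

Definition gsub_act (x : {x : X | P x}) (g : gT) : {x : X | P x} :=
  exist _ (val x *^ g) (PJ g (valP x)).

Fact gsub_act1 : gsub_act^~ 1%g =1 id.
Proof. by move=> x; apply: val_inj; rewrite /= gact1. Qed.

Fact gsub_actM x : act_morph gsub_act x.
Proof. by move=> g h; apply: val_inj; rewrite /= gactM. Qed.

Definition gsub : gset gT := gset_of gsub_act1 gsub_actM.

Definition gsub_val : gmap gsub X :=
  @GMap gT gsub X val (fun _ _ => erefl).

End Subsets.

Section Constructions.
Variable gT : finGroupType.
Implicit Types X Y Z A B : gset gT.

Definition gempty_act (x : void) (g : gT) : void := x.
Fact gempty_act1 : gempty_act^~ 1%g =1 id. Proof. by []. Qed.
Fact gempty_actM x : act_morph gempty_act x. Proof. by []. Qed.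
Definition gempty : gset gT := gset_of gempty_act1 gempty_actM.

Definition ginit X : gmap gempty X :=
  @GMap gT gempty X (fun x => match x : void with end)
    (fun x => match x : void with end).

Definition gsum_act X Y (z : X + Y) (g : gT) : X + Y :=
  match z with inl x => inl (x *^ g) | inr y => inr (y *^ g) end.
Fact gsum_act1 X Y : (@gsum_act X Y)^~ 1%g =1 id.
Proof. by case=> x /=; rewrite gact1. Qed.
Fact gsum_actM X Y z : act_morph (@gsum_act X Y) z.
Proof. by case: z => x g h /=; rewrite gactM. Qed.
Definition gsum X Y : gset gT := gset_of (@gsum_act1 X Y) (@gsum_actM X Y).

Definition ginl X Y : gmap X (gsum X Y) :=
  @GMap gT X (gsum X Y) inl (fun _ _ => erefl).
Definition ginr X Y : gmap Y (gsum X Y) :=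
  @GMap gT Y (gsum X Y) inr (fun _ _ => erefl).

Definition gcase X Y Z (f : gmap X Z) (e : gmap Y Z) : gmap (gsum X Y) Z.
Proof.
exists (fun z : gsum X Y => match z with inl x => f x | inr y => e y end).
by case=> x g; exact: gmapJ.
Defined.

Definition gfold X : gmap (gsum X X) X := gcase (gid X) (gid X).

Definition gsummap X X' Y Y' (f : gmap X X') (e : gmap Y Y') :
    gmap (gsum X Y) (gsum X' Y') :=
  gcase (gcomp (ginl X' Y') f) (gcomp (ginr X' Y') e).

Definition gprod_act X Y (z : X * Y) (g : gT) : X * Y := (z.1 *^ g, z.2 *^ g).
Fact gprod_act1 X Y : (@gprod_act X Y)^~ 1%g =1 id.
Proof. by case=> x y; rewrite /gprod_act !gact1. Qed.
Fact gprod_actM X Y z : act_morph (@gprod_act X Y) z.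
Proof. by move=> g h; rewrite /gprod_act /= !gactM. Qed.
Definition gprod X Y : gset gT := gset_of (@gprod_act1 X Y) (@gprod_actM X Y).

Definition gfst X Y : gmap (gprod X Y) X :=
  @GMap gT (gprod X Y) X fst (fun _ _ => erefl).
Definition gsnd X Y : gmap (gprod X Y) Y :=
  @GMap gT (gprod X Y) Y snd (fun _ _ => erefl).

Definition gprodmap X X' Y Y' (f : gmap X X') (e : gmap Y Y') :
  gmap (gprod X Y) (gprod X' Y').
Proof.
exists (fun z : gprod X Y => (f z.1, e z.2) : gprod X' Y').
by case=> x y g /=; rewrite !gmapJ.
Defined.

Fact gpull_subproof X Y Z (f : gmap X Z) (e : gmap Y Z) (z : gprod X Y) g :
  f z.1 == e z.2 -> f (z *^ g).1 == e (z *^ g).2.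
Proof. by move=> /eqP fe; rewrite /= !gmapJ fe. Qed.
Definition gpull X Y Z (f : gmap X Z) (e : gmap Y Z) : gset gT :=
  gsub (@gpull_subproof X Y Z f e).
Definition gpull1 X Y Z (f : gmap X Z) (e : gmap Y Z) : gmap (gpull f e) X :=
  gcomp (gfst X Y) (gsub_val _).
Definition gpull2 X Y Z (f : gmap X Z) (e : gmap Y Z) : gmap (gpull f e) Y :=
  gcomp (gsnd X Y) (gsub_val _).

(* Partial functions from A to B, with G acting by conjugation. *)
Definition gpfun_act A B (s : {ffun A -> option B}) (g : gT) :
    {ffun A -> option B} :=
  [ffun a : A => omap (fun b : B => b *^ g) (s (a *^ g^-1%g))].
Fact gpfun_act1 A B : (@gpfun_act A B)^~ 1%g =1 id.
Proof.
move=> s; apply/ffunP=> a; rewrite ffunE invg1 gact1.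
by case: (s a) => //= b; rewrite gact1.
Qed.
Fact gpfun_actM A B s : act_morph (@gpfun_act A B) s.
Proof.
move=> g h; apply/ffunP=> a; rewrite !ffunE invMg gactM.
by case: (s _) => //= b; rewrite gactM.
Qed.
Definition gpfun A B : gset gT := gset_of (@gpfun_act1 A B) (@gpfun_actM A B).

End Constructions.

(** ** Orbits G/H

   With right actions, G/H is the set of right cosets [H :* x]; the canonical
   projection to G/K sends [H :* x] to [K * (H :* x) = K :* x]. *)

Section Orbits.
Variable gT : finGroupType.
Implicit Types H K : {group gT}.

Definition gsets : gset gT := GSet ('Rs)%act.

Fact gorb_subproof H (C : gsets) g :
  C \in rcosets H [set: gT] -> C *^ g \in rcosets H [set: gT].
Proof.
case/rcosetsP=> x _ ->; apply/rcosetsP; exists (x * g)%g; first exact: in_setT.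
by rewrite /gact /= rcosetE rcosetM.
Qed.
Definition gorb H : gset gT := gsub (@gorb_subproof H).

Fact gproj_subproof H K (sHK : H \subset K) (C : gorb H) :
  (K * val C)%g \in rcosets K [set: gT].
Proof.
case/rcosetsP: (valP C) => x _ ->; apply/rcosetsP; exists x => //.
by rewrite mulgA mulGSid.
Qed.
Definition gproj H K (sHK : H \subset K) : gmap (gorb H) (gorb K).
Proof.
exists (fun C : gorb H =>
  exist (fun D : gsets => D \in rcosets K [set: gT]) (K * val C)%g
    (gproj_subproof sHK C) : gorb K).
by move=> C g; apply: val_inj; rewrite /gact /= /gact /= !rcosetE mulgA.
Defined.

End Orbits.

(** * Spans and bispans *)

Section Bispans.
Variable gT : finGroupType.
Implicit Types X Y Z : gset gT.

Record bispan X Y := Bispan {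
  bsrc : gset gT;
  btgt : gset gT;
  bleft : gmap bsrc X;
  bmid : gmap bsrc btgt;
  bright : gmap btgt Y }.

(* A morphism X -> Y of the category P_G is a class of bispans for this
   relation. *)
Definition bispan_iso X Y (f f' : bispan X Y) : Prop :=
  exists (u : gmap (bsrc f) (bsrc f')) (v : gmap (btgt f) (btgt f')),
    [/\ bijective u /\ bijective v,
        forall a, bleft f' (u a) = bleft f a,
        forall a, bmid f' (u a) = v (bmid f a) &
        forall b, bright f' (v b) = bright f b].

Definition bid X : bispan X X := Bispan (gid X) (gid X) (gid X).

(* Composition of [X <- A -> B -> Y] followed by [Y <- A' -> B' -> Z].
   A function [s] on the fibre q'^-1(b') is encoded as a partial function on A'
   whose domain of definition is that fibre. *)
Section Composition.
Variables (X Y Z : gset gT) (f' : bispan Y Z) (f : bispan X Y).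

Definition bcomp_sec (x : gprod (btgt f') (gpfun (bsrc f') (btgt f))) : bool :=
  [forall a' : bsrc f',
     match x.2 a' with
     | Some b => (bmid f' a' == x.1) && (bright f b == bleft f' a')
     | None => bmid f' a' != x.1
     end].

Fact bcomp_secJ x g : bcomp_sec x -> bcomp_sec (x *^ g).
Proof.
move=> /forallP sx; apply/forallP=> a' /=; rewrite ffunE.
have := sx (a' *^ g^-1%g).
have gK (W : gset gT) (w : W) : w *^ g^-1%g *^ g = w.
  by rewrite -gactM mulVg gact1.
case: (x.2 _) => [b|] /=.
  case/andP=> /eqP qa /eqP rb.
  by rewrite -qa gmapJ gK eqxx gmapJ rb gmapJ gK eqxx.
by apply: contraNneq => qa; rewrite gmapJ qa -gactM mulgV gact1.
Qed.

Definition bcomp_tgt : gset gT := gsub bcomp_secJ.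

(* The pullback of W = B'' x_{B'} A' and A over B: since the map W -> B is
   (a', s) |-> s a', the condition on ((b', s), a', a) is s a' = q a. *)
Definition bcomp_pull (w : gprod (gprod bcomp_tgt (bsrc f')) (bsrc f)) : bool :=
  (bmid f' w.1.2 == (val w.1.1).1)
  && ((val w.1.1).2 w.1.2 == Some (bmid f w.2)).

Fact bcomp_pullJ w g : bcomp_pull w -> bcomp_pull (w *^ g).
Proof.
case/andP=> /eqP qa /eqP sa; rewrite /bcomp_pull /= ffunE.
by rewrite -gactM mulgV gact1 sa /= !gmapJ qa !eqxx.
Qed.

Definition bcomp_src : gset gT := gsub bcomp_pullJ.

Definition bcomp : bispan X Z :=
  @Bispan X Z bcomp_src bcomp_tgt
    (gcomp (bleft f) (gcomp (gsnd _ _) (gsub_val _)))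
    (gcomp (gfst _ _) (gcomp (gfst _ _) (gsub_val _)))
    (gcomp (bright f') (gcomp (gfst _ _) (gsub_val _))).

End Composition.

Record span X Y := Span {
  sapex : gset gT;
  sleft : gmap sapex X;
  sright : gmap sapex Y }.

Definition span_iso X Y (f f' : span X Y) : Prop :=
  exists u : gmap (sapex f) (sapex f'),
    [/\ bijective u,
        forall a, sleft f' (u a) = sleft f a &
        forall a, sright f' (u a) = sright f a].

Definition sid X : span X X := Span (gid X) (gid X).

Definition scomp X Y Z (f' : span Y Z) (f : span X Y) : span X Z :=
  Span (gcomp (sleft f) (gpull1 (sright f) (sleft f')))
       (gcomp (sright f') (gpull2 (sright f) (sleft f'))).

Definition sprod X X' Y Y' (f : span X X') (e : span Y Y') :
    span (gprod X Y) (gprod X' Y') :=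
  Span (gprodmap (sleft f) (sleft e)) (gprodmap (sright f) (sright e)).

Definition bspan X Y (f : span X Y) : bispan X Y :=
  Bispan (sleft f) (gid (sapex f)) (sright f).

(* Restriction, transfer and norm along an equivariant map. *)
Definition sres X Y (f : gmap X Y) : span Y X := Span f (gid X).
Definition str X Y (f : gmap X Y) : span X Y := Span (gid X) f.
Definition bres X Y (f : gmap X Y) : bispan Y X := bspan (sres f).
Definition btr X Y (f : gmap X Y) : bispan X Y := bspan (str f).
Definition bnm X Y (f : gmap X Y) : bispan X Y := Bispan (gid X) f (gid Y).

(** ** The semiring of bispans from X to Y *)

Definition bzero X Y : bispan X Y :=
  Bispan (ginit X) (gid (gempty gT)) (ginit Y).

Definition badd X Y (f f' : bispan X Y) : bispan X Y :=
  Bispan (gcase (bleft f) (bleft f')) (gsummap (bmid f) (bmid f'))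
         (gcase (bright f) (bright f')).

Definition bone X Y : bispan X Y := Bispan (ginit X) (ginit Y) (gid Y).

Section Product.
Variables (X Y : gset gT) (f f' : bispan X Y).

Let AB' := gpull (gcomp (bright f) (bmid f)) (bright f').
Let A'B := gpull (gcomp (bright f') (bmid f')) (bright f).
Let BB' := gpull (bright f) (bright f').

Definition bmul_midl : gmap AB' BB'.
Proof.
exists (fun z : AB' => exist _ (bmid f (val z).1, (val z).2) (valP z) : BB').
by move=> z g; apply: val_inj; rewrite /= gmapJ.
Defined.

Definition bmul_midr : gmap A'B BB'.
Proof.
exists (fun z : A'B => exist _ ((val z).2, bmid f' (val z).1)
          (etrans (eq_sym _ _) (valP z)) : BB').
by move=> z g; apply: val_inj; rewrite /= gmapJ.
Defined.

Definition bmul : bispan X Y :=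
  Bispan (gcase (gcomp (bleft f) (gpull1 _ _)) (gcomp (bleft f') (gpull1 _ _)))
         (gcase bmul_midl bmul_midr)
         (gcomp (bright f) (gpull1 (bright f) (bright f'))).

End Product.

End Bispans.

(** * Mackey functors *)

(* Product-preserving functors from spans to sets whose canonical additive
   structure (transfer along the fold map) is an abelian group. *)
Record mackey (gT : finGroupType) := Mackey {
  mk_obj :> gset gT -> zmodType;
  mk_map : forall X Y : gset gT, span X Y -> mk_obj X -> mk_obj Y;
  mk_iso : forall (X Y : gset gT) (f f' : span X Y),
    span_iso f f' -> mk_map f =1 mk_map f';
  mk_id : forall X : gset gT, mk_map (sid X) =1 id;
  mk_comp : forall (X Y Z : gset gT) (f' : span Y Z) (f : span X Y),
    mk_map (scomp f' f) =1 mk_map f' \o mk_map f;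
  mk_terminal : forall z z' : mk_obj (gempty gT), z = z';
  mk_product : forall X Y : gset gT,
    bijective (fun z => (mk_map (sres (ginl X Y)) z,
                         mk_map (sres (ginr X Y)) z));
  mk_zero : forall (Y : gset gT) z, mk_map (str (ginit Y)) z = 0;
  mk_add : forall (Y : gset gT) z,
    mk_map (str (gfold Y)) z
    = mk_map (sres (ginl Y Y)) z + mk_map (sres (ginr Y Y)) z }.

Record mackey_hom (gT : finGroupType) (M N : mackey gT) := MackeyHom {
  mh_fun :> forall Y : gset gT, M Y -> N Y;
  mh_nat : forall (X Y : gset gT) (f : span X Y) (m : M X),
    mh_fun (mk_map f m) = mk_map f (mh_fun m) }.

(** ** Day convolution *)

Definition mackey_pairing (gT : finGroupType) (M N P : mackey gT)
    (t : forall X Y : gset gT, M X -> N Y -> P (gprod X Y)) : Prop :=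
  [/\ forall (X Y : gset gT) (m m' : M X) (n : N Y),
        t X Y (m + m') n = t X Y m n + t X Y m' n,
      forall (X Y : gset gT) (m : M X) (n n' : N Y),
        t X Y m (n + n') = t X Y m n + t X Y m n' &
      forall (X X' Y Y' : gset gT) (f : span X X') (e : span Y Y') m n,
        t X' Y' (mk_map f m) (mk_map e n) = mk_map (sprod f e) (t X Y m n)].

(* S, with the pairing t, is the left Kan extension along the product of
   G-sets of (X, Y) |-> M X (x) N Y. *)
Definition day_convolution (gT : finGroupType) (M N S : mackey gT)
    (t : forall X Y : gset gT, M X -> N Y -> S (gprod X Y)) : Prop :=
  mackey_pairing t /\
  forall (P : mackey gT) (p : forall X Y : gset gT, M X -> N Y -> P (gprod X Y)),
    mackey_pairing p ->
    exists h : mackey_hom S P,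
      (forall (X Y : gset gT) m n, h _ (t X Y m n) = p X Y m n) /\
      forall h' : mackey_hom S P,
        (forall (X Y : gset gT) m n, h' _ (t X Y m n) = p X Y m n) ->
        forall Y (s : S Y), h' Y s = h Y s.

(** * Tambara functors *)

(* A product-preserving functor from P_G to sets whose canonical semiring
   structure (transfer and norm along the fold map) is a ring; the last four
   fields say that the ring structure recorded in [tb_obj] is that one. *)
Record tambara (gT : finGroupType) := Tambara {
  tb_obj :> gset gT -> comPzRingType;
  tb_map : forall X Y : gset gT, bispan X Y -> tb_obj X -> tb_obj Y;
  tb_iso : forall (X Y : gset gT) (f f' : bispan X Y),
    bispan_iso f f' -> tb_map f =1 tb_map f';
  tb_id : forall X : gset gT, tb_map (bid X) =1 id;
  tb_comp : forall (X Y Z : gset gT) (f' : bispan Y Z) (f : bispan X Y),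
    tb_map (bcomp f' f) =1 tb_map f' \o tb_map f;
  tb_terminal : forall z z' : tb_obj (gempty gT), z = z';
  tb_product : forall X Y : gset gT,
    bijective (fun z => (tb_map (bres (ginl X Y)) z,
                         tb_map (bres (ginr X Y)) z));
  tb_zero : forall (Y : gset gT) z, tb_map (btr (ginit Y)) z = 0;
  tb_add : forall (Y : gset gT) z,
    tb_map (btr (gfold Y)) z
    = tb_map (bres (ginl Y Y)) z + tb_map (bres (ginr Y Y)) z;
  tb_one : forall (Y : gset gT) z, tb_map (bnm (ginit Y)) z = 1;
  tb_mul : forall (Y : gset gT) z,
    tb_map (bnm (gfold Y)) z
    = tb_map (bres (ginl Y Y)) z * tb_map (bres (ginr Y Y)) z }.

Record tambara_hom (gT : finGroupType) (S T : tambara gT) := TambaraHom {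
  th_fun :> forall Y : gset gT, S Y -> T Y;
  th_nat : forall (X Y : gset gT) (f : bispan X Y) (s : S X),
    th_fun (tb_map f s) = tb_map f (th_fun s) }.

Definition Res (gT : finGroupType) (T : tambara gT) (H K : {group gT})
    (sHK : H \subset K) : T (gorb K) -> T (gorb H) :=
  tb_map (bres (gproj sHK)).

Section UnderlyingMackey.
Variable gT : finGroupType.

Lemma inj_surj_bij (A B : finType) (u : A -> B) :
  injective u -> (forall b, exists a, u a = b) -> bijective u.
Proof.
move=> ui us; have us' b : exists a, u a == b.
  by have [a <-] := us b; exists a.
have uK b : u (xchoose (us' b)) = b by apply/eqP/(xchooseP (us' b)).
by exists (fun b => xchoose (us' b)) => // a; apply: ui.
Qed.

Lemma bspan_iso (X Y : gset gT) (f f' : span X Y) :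
  span_iso f f' -> bispan_iso (bspan f) (bspan f').
Proof. by case=> u [ub lu ru]; exists u, u. Qed.

Section Comp.
Variables (X Y Z : gset gT) (f' : span Y Z) (f : span X Y).

Let P := sapex (scomp f' f).
Let C := bcomp (bspan f') (bspan f).

Definition bspan_sec (z : P) : gpfun (sapex f') (sapex f) :=
  [ffun b => if b == (val z).2 then Some (val z).1 else None].

Fact bspan_secP (z : P) :
  @bcomp_sec _ X Y Z (bspan f') (bspan f) ((val z).2, bspan_sec z).
Proof.
apply/forallP=> b /=; rewrite ffunE; case: (b =P (val z).2) => //= ->.
exact: (valP z).
Qed.

Definition bspan_tgt_fun (z : P) : btgt C := 
  exist (bcomp_sec (f' := bspan f') (f := bspan f)) ((val z).2, bspan_sec z)
    (bspan_secP z).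

Fact bspan_tgtJ z g : bspan_tgt_fun (z *^ g) = bspan_tgt_fun z *^ g.
Proof.
apply: val_inj; congr pair; apply/ffunP=> b /=; rewrite !ffunE /=.
rewrite -[(val z).2 in RHS](_ : (val z).2 *^ g *^ g^-1%g = _); last first.
  by rewrite -gactM mulgV gact1.
rewrite (inj_eq (f := fun w => gact w g^-1%g)) /=; last exact: act_inj.
by case: eqP.
Qed.

Definition bspan_tgt : gmap P (btgt C) := GMap bspan_tgtJ.

Fact bspan_srcP (z : P) :
  @bcomp_pull _ X Y Z (bspan f') (bspan f)
    ((bspan_tgt z, (val z).2), (val z).1).
Proof. by rewrite /bcomp_pull /= ffunE !eqxx. Qed.

Definition bspan_src_fun (z : P) : bsrc C := 
  exist (bcomp_pull (f' := bspan f') (f := bspan f))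
    ((bspan_tgt z, (val z).2), (val z).1) (bspan_srcP z).

Fact bspan_srcJ z g : bspan_src_fun (z *^ g) = bspan_src_fun z *^ g.
Proof. by apply: val_inj; rewrite /= bspan_tgtJ. Qed.

Definition bspan_src : gmap P (bsrc C) := GMap bspan_srcJ.

Lemma bspan_comp : bispan_iso (bspan (scomp f' f)) C.
Proof.
have tgt_inj : injective bspan_tgt.
  move=> z w /(congr1 val) [e2 /ffunP/(_ (val z).2)].
  rewrite !ffunE e2 eqxx => -[e1].
  by apply: val_inj; rewrite [val z]surjective_pairing e1 e2 -surjective_pairing.
have tgt_surj c : exists z, bspan_tgt z = c.
  case: c => -[b s] sP; have /forallP sP' := sP.
  have := sP' b; rewrite /=; case sb: (s b) => [a|]; last by rewrite eqxx.
  case/andP=> _ rl; exists (exist _ (a, b) rl); apply: val_inj.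
  congr pair; apply/ffunP=> b1; rewrite ffunE /=.
  case: eqP => [->|nb]; first by rewrite sb.
  by have := sP' b1; rewrite /=; case: (s b1) => //= a1 /andP[/eqP].
exists bspan_src, bspan_tgt; split=> //; split; last exact: inj_surj_bij.
apply: inj_surj_bij => [z w /(congr1 (fun c => (val c).1.1)) /tgt_inj //|c].
have [z zc] := tgt_surj (val c).1.1; exists z; apply: val_inj.
case: c zc => -[[c b] a] cP /= zc; move: cP; rewrite -zc.
case/andP=> /= /eqP eb /eqP; rewrite eb ffunE eqxx => -[ea].
by rewrite ea.
Qed.

End Comp.

Variable T : tambara gT.

Fact um_iso (X Y : gset gT) (f f' : span X Y) :
  span_iso f f' -> tb_map (t := T) (bspan f) =1 tb_map (bspan f').
Proof. by move=> /bspan_iso /tb_iso. Qed.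

Fact um_comp (X Y Z : gset gT) (f' : span Y Z) (f : span X Y) :
  tb_map (t := T) (bspan (scomp f' f))
  =1 tb_map (bspan f') \o tb_map (bspan f).
Proof. by move=> z; rewrite (tb_iso (bspan_comp f' f)) tb_comp. Qed.

Definition underlying_mackey : mackey gT :=
  @Mackey gT (fun Y => T Y) (fun X Y f => tb_map (bspan f))
    um_iso (@tb_id gT T) um_comp (@tb_terminal gT T) (@tb_product gT T)
    (@tb_zero gT T) (@tb_add gT T).

End UnderlyingMackey.

(** ** Box products

   S, with the maps i : T -> S and j : U -> S, is the box product of T and U:
   its underlying Mackey functor is the Day convolution of those of T and U by
   the external product t, u |-> i(t) j(u). *)
Definition box_product (gT : finGroupType) (T U S : tambara gT)
    (i : tambara_hom T S) (j : tambara_hom U S) : Prop :=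
  @day_convolution gT (underlying_mackey T) (underlying_mackey U)
    (underlying_mackey S)
    (fun X Y (t : T X) (u : U Y) =>
       tb_map (bres (gfst X Y)) (i X t) * tb_map (bres (gsnd X Y)) (j Y u)).

(** ** The free Tambara functor A[X] *)

(* R is the group completion of the semiring P_G(X, Y): the semiring map [eta]
   identifies R with formal differences of bispans. *)
Record group_completion (gT : finGroupType) (X Y : gset gT)
    (R : comPzRingType) (eta : bispan X Y -> R) : Prop := GroupCompletion {
  gc_iso : forall f f', bispan_iso f f' -> eta f = eta f';
  gc_zero : eta (bzero X Y) = 0;
  gc_add : forall f f', eta (badd f f') = eta f + eta f';
  gc_one : eta (bone X Y) = 1;
  gc_mul : forall f f', eta (bmul f f') = eta f * eta f';
  gc_diff : forall r, exists f f', r = eta f - eta f';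
  gc_eq : forall f1 f1' f2 f2',
    eta f1 - eta f1' = eta f2 - eta f2' <->
    exists d, bispan_iso (badd (badd f1 f2') d) (badd (badd f2 f1') d) }.

Definition free_tambara (gT : finGroupType) (X : gset gT) (A : tambara gT)
    (eta : forall Y : gset gT, bispan X Y -> A Y) : Prop :=
  (forall Y : gset gT, group_completion (eta Y)) /\
  (forall (Y Z : gset gT) (f' : bispan Y Z) (f : bispan X Y),
     eta Z (bcomp f' f) = tb_map f' (eta Y f)).

(** * Finiteness conditions *)

Definition is_ideal (R : comPzRingType) (I : R -> Prop) : Prop :=
  [/\ I 0, forall x y, I x -> I y -> I (x + y) &
      forall r x, I x -> I (r * x)].

Definition noetherian (R : comPzRingType) : Prop :=
  forall I : R -> Prop, is_ideal I ->
  exists (n : nat) (a : 'I_n -> R), (forall k, I (a k)) /\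
    forall x, I x -> exists c : 'I_n -> R, x = \sum_(k < n) c k * a k.

Definition is_subring (R : comPzRingType) (S : R -> Prop) : Prop :=
  [/\ S 1, forall x y, S x -> S y -> S (x - y) &
      forall x y, S x -> S y -> S (x * y)].

(* Finitely generated as a Z-algebra. *)
Definition finitely_generated (R : comPzRingType) : Prop :=
  exists (n : nat) (a : 'I_n -> R),
    forall S : R -> Prop, is_subring S -> (forall k, S (a k)) -> forall x, S x.

Definition finite_map (R S : comPzRingType) (f : R -> S) : Prop :=
  exists (n : nat) (a : 'I_n -> S),
    forall y, exists c : 'I_n -> R, y = \sum_(k < n) f (c k) * a k.

(* A[X](G/L) is any group completion of the semiring P_G(X, G/L). *)
Definition tambara_finite (gT : finGroupType) : Prop :=
  forall (X : gset gT) (L : {group gT}) (R : comPzRingType)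
         (eta : bispan X (gorb L) -> R),
    group_completion eta -> finitely_generated R.

Definition levelwise_noetherian (gT : finGroupType) (T : tambara gT) : Prop :=
  forall L : {group gT}, noetherian (T (gorb L)).

Definition levelwise_finitely_generated (gT : finGroupType)
    (T : tambara gT) : Prop :=
  forall L : {group gT}, finitely_generated (T (gorb L)).

Definition relatively_finite_dimensional (gT : finGroupType)
    (T : tambara gT) : Prop :=
  forall (H K : {group gT}) (sHK : H \subset K), finite_map (@Res gT T H K sHK).

(* Main.v *)
(* The Day convolution is generated by the pairing, so every element of
   T[X](G/L) is a sum of transfers tr_H^L (i t * j a) with H <= L, t in T(G/H)
   and a in A[X](G/H).  If T(G/H) is spanned over T(G/L) by finitely many t_k and
   A[X](G/H) over A[X](G/L) by finitely many a_l, Frobenius reciprocity shows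
   that the finitely many tr_H^L (i t_k * j a_l) span T[X](G/L) over the ring
   generated by i(T(G/L)) and j(A[X](G/L)); this ring is a finitely generated
   algebra over the Noetherian ring i(T(G/L)), so Hilbert's basis theorem applies.

   It remains to see that A[X] is relatively finite-dimensional.  As A[X](G/H) is
   a finitely generated ring, it is enough that the class x of a bispan is
   integral over the image of restriction.  The elementary symmetric functions of
   the conjugates of x are bispans E_k over G/L, those of the conjugates other
   than x are bispans F_k over G/H, and Res E_k+1 = F_k+1 + x F_k with F_0 = 1 and
   F_k = 0 for large k. *)

From HB Require Import structures.
From mathcomp Require Import all_boot all_order all_algebra all_fingroup.
From mathcomp Require Import boolp.
Require Import Defs.

Set Implicit Arguments.
Unset Strict Implicit.
Unset Printing Implicit Defensive.

Import GRing.Theory.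
Local Open Scope ring_scope.

(** * Noetherian modules inside a commutative ring *)

Definition image_of (R S : Type) (f : R -> S) : S -> Prop :=
  fun y => exists r, y = f r.

Section Stable.
Variable S : comPzRingType.
Implicit Types (Q M N : S -> Prop) (s : seq S).

(* Q is a mere set of multipliers: [stable Q N] says that N is a module over the
   subring generated by Q. *)
Definition stable Q N : Prop :=
  [/\ N 0, forall x y, N x -> N y -> N (x - y) &
      forall q x, Q q -> N x -> N (q * x)].

(** Encoded as the intersection of all [Q]-modules containing [s]: this makes sense for a mere set
    [Q], and a hypothesis [mspan Q s x] can be applied directly as an induction principle. *)
Definition mspan Q s x : Prop :=
  forall N, stable Q N -> (forall y, y \in s -> N y) -> N x.

Definition noeth Q M : Prop :=
  forall N, stable Q N -> (forall x, N x -> M x) ->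
  exists s, (forall y, y \in s -> N y) /\ forall x, N x -> mspan Q s x.

Lemma stableN Q N x : stable Q N -> N x -> N (- x).
Proof. by case=> N0 NB _ Nx; rewrite -sub0r; exact: NB. Qed.

Lemma stableD Q N x y : stable Q N -> N x -> N y -> N (x + y).
Proof.
move=> Nst Nx Ny; rewrite -[y]opprK; case: (Nst) => _ NB _.
by apply: NB => //; exact: stableN Nst _.
Qed.

Lemma stable_sum Q N (I : Type) (r : seq I) (P : pred I) (F : I -> S) :
  stable Q N -> (forall k, P k -> N (F k)) -> N (\sum_(k <- r | P k) F k).
Proof.
move=> Nst NF; apply: (big_ind N) => //; first by case: Nst.
by move=> x y; exact: stableD Nst.
Qed.

Lemma stableS Q Q' N : (forall q, Q q -> Q' q) -> stable Q' N -> stable Q N.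
Proof. by move=> sQ [N0 NB NM]; split=> // q x /sQ; exact: NM. Qed.

Lemma mspan_stable Q s : stable Q (mspan Q s).
Proof.
split=> [N Nst _ | x y sx sy N Nst sN | q x Qq sx N Nst sN].
- by case: Nst.
- by case: (Nst) => _ NB _; apply: NB; [exact: sx | exact: sy].
- by case: (Nst) => _ _ NM; apply: NM => //; exact: sx.
Qed.

Lemma mspan_mem Q s x : x \in s -> mspan Q s x.
Proof. by move=> xs N _; exact. Qed.

Lemma mspanS Q Q' s s' x :
  (forall q, Q q -> Q' q) -> {subset s <= s'} -> mspan Q s x -> mspan Q' s' x.
Proof.
move=> sQ ss' sx N Nst sN; apply: sx; first exact: stableS sQ Nst.
by move=> y /ss'; exact: sN.
Qed.

Lemma mspan_nil Q x : mspan Q [::] x -> x = 0.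
Proof.
move=> sx; apply: (sx (fun y => y = 0)) => //.
split=> // [_ _ -> -> | q _ _ ->]; first by rewrite subr0.
by rewrite mulr0.
Qed.

(** Since the image of [f] is a subring, the elements of this form already make up a module
    containing the generators. *)
Lemma mspan_cons (R : comPzRingType) (f : {rmorphism R -> S}) w s x :
  mspan (image_of f) (w :: s) x ->
  exists r m, mspan (image_of f) s m /\ x = f r * w + m.
Proof.
set Q := image_of f => sx.
apply: (sx (fun x => exists r m, mspan Q s m /\ x = f r * w + m)) => [|y].
  have [s0 sB sM] := mspan_stable Q s; split.
  - by exists 0, 0; rewrite rmorph0 mul0r addr0.
  - move=> _ _ [r [m [sm ->]]] [r' [m' [sm' ->]]].
    exists (r - r'), (m - m'); split; first exact: sB.
    by rewrite rmorphB mulrBl opprD addrACA.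
  - move=> _ _ [r0 ->] [r [m [sm ->]]]; exists (r0 * r), (f r0 * m); split.
      by apply: sM => //; exists r0.
    by rewrite rmorphM mulrDr mulrA.
rewrite in_cons => /predU1P[-> | ys].
  exists 1, 0; rewrite rmorph1 mul1r addr0; split=> //.
  by case: (mspan_stable Q s).
exists 0, y; rewrite rmorph0 mul0r add0r; split=> //; exact: mspan_mem.
Qed.

(** Induction on the generators. The coefficients of [w] in elements of [N] form an ideal of [R];
    lifts of its finitely many generators, together with generators of the part of [N] inside
    [mspan Q s], generate [N]. *)
Lemma noeth_mspan (R : comPzRingType) (f : {rmorphism R -> S}) s :
  noetherian R ->
  noeth (image_of f) (mspan (image_of f) s).
Proof.
set Q := image_of f => noethR; elim: s => [|w s IH] N Nst sN.
  by exists [::]; split=> // x /sN/mspan_nil->; case: (mspan_stable Q [::]).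
have [N0 NB NM] := Nst.
have sst := mspan_stable Q s; have [s0 sB sM] := sst.
pose I r := exists2 m, mspan Q s m & N (f r * w + m).
have [|n [a [Ia genI]]] := noethR I.
  split.
  - by exists 0; rewrite // rmorph0 mul0r addr0.
  - move=> r r' [m sm Nm] [m' sm' Nm']; exists (m + m').
      exact: stableD sst _ _.
    by rewrite rmorphD mulrDl addrACA; apply: stableD Nst _ _.
  - move=> c r [m sm Nm]; exists (f c * m); first by apply: sM => //; exists c.
    by rewrite rmorphM -mulrA -mulrDr; apply: NM => //; exists c.
have /choice[m mP] : forall k, exists m, mspan Q s m /\ N (f (a k) * w + m).
  by move=> k; have [m] := Ia k; exists m.
have [|x [] //|t [tN genN]] := IH (fun x => N x /\ mspan Q s x).
  split=> // [x y [Nx sx] [Ny sy]|q x Qq [Nx sx]].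
    by split; [exact: NB | exact: sB].
  by split; [exact: NM | exact: sM].
pose u k := f (a k) * w + m k.
exists (codom u ++ t); split=> [y|x Nx].
  rewrite mem_cat => /orP[/codomP[k ->]|/tN[] //].
  by have [] := mP k.
have [r [m' [sm' xE]]] := mspan_cons (sN x Nx).
have [|c rE] := genI r; first by exists m'; rewrite -?xE.
have ust := mspan_stable Q (codom u ++ t).
have uP : mspan Q (codom u ++ t) (\sum_(k < n) f (c k) * u k).
  apply: (stable_sum _ ust) => k _.
  case: ust => _ _; apply; first by exists (c k).
  by apply: mspan_mem; rewrite mem_cat codom_f.
(* Subtracting this combination of the lifts [u k] cancels the [w]-term, so the difference lies in
   [N] and in the span of [s], where the induction hypothesis applies. *)
rewrite -[x](subrK (\sum_(k < n) f (c k) * u k)).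
apply: (stableD ust) => //.
apply: (@mspanS Q Q t) => // [y yt|]; first by rewrite mem_cat yt orbT.
apply: genN; split.
  apply: NB => //; apply: (stable_sum _ Nst) => k _; apply: NM; first by exists (c k).
  by have [] := mP k.
have -> : x - \sum_(k < n) f (c k) * u k = m' - \sum_(k < n) f (c k) * m k.
  under eq_bigr do rewrite mulrDr.
  rewrite xE rE rmorph_sum mulr_suml big_split opprD addrACA.
  under [X in X - _ + _]eq_bigr do rewrite rmorphM -mulrA.
  by rewrite subrr add0r.
apply: sB => //; apply: (stable_sum _ sst) => k _; apply: sM; first by exists (c k).
by have [] := mP k.
Qed.

End Stable.

(** * Hilbert's basis theorem for modules *)

Section Hilbert.
Variables (S : comPzRingType) (Q M : S -> Prop) (x : S).
Hypotheses (Mst : stable Q M) (nM : noeth Q M).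
Let Q' q := Q q \/ q = x.

(* Elements of S having some expression of degree < d in x with coefficients in
   M; such an expression need not be unique. *)
Fixpoint deglt d : S -> Prop :=
  if d is d'.+1 then fun y => exists m p, [/\ M m, deglt d' p & y = m * x ^+ d' + p]
  else fun y => y = 0.

Lemma deglt_stable d : stable Q (deglt d).
Proof.
have [M0 MB MM] := Mst; elim: d => [|d [IH0 IHB IHM]] /=; split=> //.
- by move=> _ _ -> ->; rewrite subr0.
- by move=> q _ _ ->; rewrite mulr0.
- by exists 0, 0; rewrite mul0r addr0.
- move=> _ _ [m [p [Mm dp ->]]] [m' [p' [Mm' dp' ->]]].
  exists (m - m'), (p - p'); split; [exact: MB | exact: IHB |].
  by rewrite mulrBl opprD addrACA.
- move=> q _ Qq [m [p [Mm dp ->]]]; exists (q * m), (q * p).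
  by split; [exact: MM | exact: IHM | rewrite mulrDr mulrA].
Qed.

Lemma deglt_mulx d y : deglt d y -> deglt d.+1 (x * y).
Proof.
elim: d y => [_ ->|d IH _ [m [p [Mm dp ->]]]].
  by rewrite mulr0; case: (deglt_stable 1).
exists m, (x * p); split=> //; first exact: IH.
by rewrite mulrDr exprS mulrCA.
Qed.

Lemma deglt_le d d' y : (d <= d')%N -> deglt d y -> deglt d' y.
Proof.
move=> le_dd' dy; elim: d' le_dd' => [|d' IH]; first by rewrite leqn0 => /eqP<-.
rewrite leq_eqVlt => /predU1P[<- // | /IH d'y]; exists 0, y; split=> //.
  by case: Mst.
by rewrite mul0r add0r.
Qed.

Definition polyspan y : Prop := exists d, deglt d y.

Lemma polyspan_stable : stable Q' polyspan.
Proof.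
split=> [|y z [d dy] [d' dz]|q y [Qq|->] [d dy]].
- by exists 0%N.
- exists (maxn d d'); have [_ dB _] := deglt_stable (maxn d d').
  by apply: dB; [apply: deglt_le dy; exact: leq_maxl
                | apply: deglt_le dz; exact: leq_maxr].
- by exists d; case: (deglt_stable d) => _ _; apply.
- by exists d.+1; exact: deglt_mulx.
Qed.

Lemma polyspan_base y : M y -> polyspan y.
Proof. by move=> My; exists 1%N, y, 0; rewrite expr0 mulr1 addr0. Qed.

(** The module of leading coefficients of [N] in degree [d]. As expressions are not unique, one
    element of [N] may contribute several coefficients. *)
Definition lead (N : S -> Prop) d m :=
  M m /\ exists2 p, deglt d p & N (m * x ^+ d + p).

Lemma lead_stable N d : stable Q N -> stable Q (lead N d).
Proof.
move=> [N0 NB NM]; have [M0 MB MM] := Mst; have [d0 dB dM] := deglt_stable d.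
split=> [|m m' [Mm [p dp Np]] [Mm' [p' dp' Np']]|q m Qq [Mm [p dp Np]]].
- by split=> //; exists 0; rewrite // mul0r addr0.
- split; first exact: MB.
  exists (p - p'); first exact: dB.
  by rewrite mulrBl addrACA -opprD; exact: NB.
- split; first exact: MM.
  exists (q * p); first exact: dM.
  by rewrite -mulrA -mulrDr; exact: NM.
Qed.

Lemma leadS (N N' : S -> Prop) d m :
  (forall y, N y -> N' y) -> lead N d m -> lead N' d m.
Proof. by move=> sN [Mm [p dp /sN Np]]; split=> //; exists p. Qed.

(** Multiplication by [x] raises the degree by one and keeps the leading coefficient. *)
Lemma lead_le N d d' m : stable Q' N -> (d <= d')%N -> lead N d m -> lead N d' m.
Proof.
move=> [_ _ NM] le_dd' ld; elim: d' le_dd' => [|d' IH].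
  by rewrite leqn0 => /eqP<-.
rewrite leq_eqVlt => /predU1P[<- // | /IH [Mm [p dp Np]]]; split=> //.
exists (x * p); first exact: deglt_mulx.
by rewrite exprS mulrCA -mulrDr; apply: NM => //; right.
Qed.

Lemma lift_lead N d (s : seq S) : (forall m, m \in s -> lead N d m) ->
  exists t : seq S, (forall y, y \in t -> N y) /\
            forall m, m \in s -> lead (mspan Q' t) d m.
Proof.
elim: s => [|m s IH] sL; first by exists [::].
have [|t [tN tL]] := IH; first by move=> y ys; apply: sL; rewrite in_cons ys orbT.
have [|Mm [p dp Np]] := sL m; first exact: mem_head.
exists (m * x ^+ d + p :: t); split=> y; rewrite in_cons => /predU1P[->//|ys].
- exact: tN.
- by split=> //; exists p => //; apply: mspan_mem; exact: mem_head.
- apply: leadS (tL y ys) => z; apply: mspanS => // w wt.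
  by rewrite in_cons wt orbT.
Qed.

(** The modules [lead N d] increase with [d] inside the Noetherian module [M], so they are constant
    from some degree [D] on. Lifts of generators in degree [D] and in the finitely many smaller
    degrees generate [N]. *)
Lemma noeth_polyspan : noeth Q' polyspan.
Proof.
move=> N Nst sN; have [N0 NB NM] := Nst.
have NstQ : stable Q N by apply: stableS Nst => q; left.
have lead_fg d : exists t : seq S, (forall y, y \in t -> N y) /\
    forall m, lead N d m -> lead (mspan Q' t) d m.
  have [m [] //|s [sL gL]] := nM (lead_stable d NstQ).
  have [t [tN tL]] := lift_lead sL; exists t; split=> // m /gL sm.
  apply: (sm (lead (mspan Q' t) d)) => //; apply: lead_stable.
  by apply: stableS (mspan_stable _ _) => q; left.
(* The union over all degrees is a module because the chain increases. *)
have [||s [sL gL]] := nM (N := fun m => exists d, lead N d m).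
- split=> [|m m' [d ld] [d' ld']|q m Qq [d ld]].
  + by exists 0%N; case: (lead_stable 0 NstQ).
  + exists (maxn d d'); have [_ LB _] := lead_stable (maxn d d') NstQ.
    by apply: LB; [apply: lead_le ld; rewrite ?leq_maxl
                  | apply: lead_le ld'; rewrite ?leq_maxr].
  + by exists d; case: (lead_stable d NstQ) => _ _; apply.
- by move=> m [d []].
have [D sD] : exists D, forall m, m \in s -> lead N D m.
  elim: s sL {gL} => [|m s IH] sL; first by exists 0%N.
  have [|D sD] := IH; first by move=> y ys; apply: sL; rewrite in_cons ys orbT.
  have [|d ld] := sL m; first exact: mem_head.
  exists (maxn d D) => y; rewrite in_cons => /predU1P[->|/sD ly].
    by apply: lead_le ld; rewrite ?leq_maxl.
  by apply: lead_le ly; rewrite ?leq_maxr.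
have [t1 [t1N t1L]] := lift_lead sD.
have [t2 [t2N t2L]] : exists t : seq S, (forall y, y \in t -> N y) /\
    forall d m, (d < D)%N -> lead N d m -> lead (mspan Q' t) d m.
  elim: (D) => [|k [t [tN tL]]]; first by exists [::].
  have [t' [t'N t'L]] := lead_fg k; exists (t' ++ t); split.
    by move=> y; rewrite mem_cat => /orP[/t'N|/tN].
  move=> d m; rewrite ltnS leq_eqVlt => /predU1P[->|ltdk] ld.
    apply: leadS (t'L m ld) => z; apply: mspanS => // w wt.
    by rewrite mem_cat wt.
  apply: leadS (tL d m ltdk ld) => z; apply: mspanS => // w wt.
  by rewrite mem_cat wt orbT.
pose t := t1 ++ t2; have tst := mspan_stable Q' t.
have tstQ : stable Q (mspan Q' t) by apply: stableS tst => q; left.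
have tN y : mspan Q' t y -> N y.
  by move=> ty; apply: ty => // z; rewrite mem_cat => /orP[/t1N|/t2N].
have tL d m : lead N d m -> lead (mspan Q' t) d m.
  move=> ld; case: (ltnP d D) => [ltdD|leDd].
    apply: leadS (t2L d m ltdD ld) => z; apply: mspanS => // w wt.
    by rewrite mem_cat wt orbT.
  have sm : mspan Q s m by apply: gL; exists d.
  apply: sm; first exact: lead_stable.
  move=> y ys; apply: (lead_le tst leDd); apply: leadS (t1L y ys) => z.
  by apply: mspanS => // w wt; rewrite mem_cat wt.
exists t; split=> [y yt|y Ny]; first by apply: tN; exact: mspan_mem.
(* Induction on the degree of an expression for [y]: subtracting an element of the span with the
   same top coefficient lowers it. *)
have [d] := sN y Ny; elim: d y Ny => [|d IH] y Ny; first by move=> ->; case: tst.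
case=> m [p [Mm dp yE]].
have [_ [p' dp' tp']] : lead (mspan Q' t) d m.
  by apply: tL; split=> //; exists p; rewrite // -yE.
rewrite -[y](subrK (m * x ^+ d + p')); apply: (stableD tst) => //.
apply: IH; first by apply: NB => //; exact: tN.
have [_ dB _] := deglt_stable d.
by rewrite yE opprD addrACA subrr add0r; exact: dB.
Qed.

End Hilbert.

(** * Isomorphisms of bispans *)

Lemma gactK (gT : finGroupType) (X : gset gT) (g : gT) :
  cancel (fun x : X => x *^ g) (fun x => x *^ g^-1%g).
Proof. by move=> x; rewrite -gactM mulgV gact1. Qed.

Lemma gactKV (gT : finGroupType) (X : gset gT) (g : gT) :
  cancel (fun x : X => x *^ g^-1%g) (fun x => x *^ g).
Proof. by move=> x; rewrite -gactM mulVg gact1. Qed.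

Lemma gact_inj (gT : finGroupType) (X : gset gT) (g : gT) :
  injective (fun x : X => x *^ g).
Proof. exact: can_inj (@gactK _ X g). Qed.

Section BispanIso.
Variable gT : finGroupType.
Implicit Types X Y Z : gset gT.

Lemma bispan_isoI X Y (f f' : bispan X Y) (u : gmap (bsrc f) (bsrc f'))
    (v : gmap (btgt f) (btgt f')) :
  injective u -> (forall b, exists a, u a = b) ->
  injective v -> (forall b, exists a, v a = b) ->
  (forall a, bleft f' (u a) = bleft f a) ->
  (forall a, bmid f' (u a) = v (bmid f a)) ->
  (forall b, bright f' (v b) = bright f b) ->
  bispan_iso f f'.
Proof. by move=> *; exists u, v; split=> //; split; apply: inj_surj_bij. Qed.

(* [e b a'] is the value at [a'] of the section attached to [b]. *)
Lemma bcomp_isoI X Y Z (f' : bispan Y Z) (f : bispan X Y) (h : bispan X Z)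
    (v : gmap (btgt h) (btgt f')) (e : btgt h -> bsrc f' -> option (btgt f))
    (u1 : gmap (bsrc h) (bsrc f')) (u2 : gmap (bsrc h) (bsrc f)) :
  (forall b a g, e (b *^ g) (a *^ g) = omap (fun c => c *^ g) (e b a)) ->
  (forall b a, match e b a with
     | Some c => (bmid f' a == v b) && (bright f c == bleft f' a)
     | None => bmid f' a != v b end) ->
  (forall b b', v b = v b' -> e b =1 e b' -> b = b') ->
  (forall (b' : btgt f') (s : bsrc f' -> option (btgt f)),
     (forall a, match s a with
       | Some c => (bmid f' a == b') && (bright f c == bleft f' a)
       | None => bmid f' a != b' end) ->
     exists b, v b = b' /\ e b =1 s) ->
  (forall x, e (bmid h x) (u1 x) = Some (bmid f (u2 x))) ->
  (forall x y, bmid h x = bmid h y -> u1 x = u1 y -> u2 x = u2 y -> x = y) ->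
  (forall b a' a, e b a' = Some (bmid f a) ->
     exists x, [/\ bmid h x = b, u1 x = a' & u2 x = a]) ->
  (forall x, bleft h x = bleft f (u2 x)) ->
  (forall b, bright h b = bright f' (v b)) ->
  bispan_iso h (bcomp f' f).
Proof.
move=> eJ eP e_inj e_surj u_e u_inj u_surj lh rh.
have sP b : bcomp_sec (f' := f') (f := f)
    ((v b, [ffun a => e b a]) : gprod (btgt f') (gpfun (bsrc f') (btgt f))).
  by apply/forallP=> a; rewrite ffunE; exact: eP.
pose V b : btgt (bcomp f' f) :=
  exist (bcomp_sec (f' := f') (f := f)) (v b, [ffun a => e b a]) (sP b).
have VJ b g : V (b *^ g) = V b *^ g.
  apply: val_inj; congr pair; first exact: gmapJ.
  by apply/ffunP=> a; rewrite !ffunE -eJ gactKV.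
have uP x : bcomp_pull (f' := f') (f := f)
    ((V (bmid h x), u1 x, u2 x) : gprod (gprod (bcomp_tgt f' f) _) _).
  rewrite /bcomp_pull /= ffunE u_e eqxx andbT.
  by have := eP (bmid h x) (u1 x); rewrite u_e => /andP[].
pose U x : bsrc (bcomp f' f) :=
  exist (bcomp_pull (f' := f') (f := f)) (V (bmid h x), u1 x, u2 x) (uP x).
have UJ x g : U (x *^ g) = U x *^ g.
  by apply: val_inj; rewrite /= !gmapJ VJ.
have V_inj : injective V.
  move=> b b' /(congr1 val) [vb /ffunP eb]; apply: e_inj => // a.
  by have := eb a; rewrite !ffunE.
have V_surj c : exists b, V b = c.
  case: c => -[b' s] sb'; have /forallP /= s_ok := sb'.
  have [b [vb eb]] := e_surj b' s s_ok; exists b; apply: val_inj.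
  by rewrite /= vb; congr pair; apply/ffunP=> a; rewrite ffunE eb.
apply: (@bispan_isoI _ _ h (bcomp f' f) (GMap UJ) (GMap VJ)) => //=.
- move=> x y /(congr1 val) [/= vb /ffunP eb xy1 xy2]; apply: u_inj => //.
  by apply: e_inj => // a; have := eb a; rewrite !ffunE.
- case=> -[[c a'] a] cP; have [b bc] := V_surj c.
  subst c; have := cP.
  rewrite /bcomp_pull /= ffunE => /andP[_ /eqP/u_surj[x [xb x1 x2]]].
  by exists x; apply: val_inj; rewrite /= xb x1 x2.
Qed.

(** Characterised on points, so that any convenient model, for instance one with an identity leg,
    can stand in for [gpull]. *)
Definition is_pullback X Y Z P (f : gmap X Z) (e : gmap Y Z) (p : gmap P X)
    (q : gmap P Y) : Prop :=
  [/\ forall z, f (p z) = e (q z),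
      forall z z', p z = p z' -> q z = q z' -> z = z' &
      forall x y, f x = e y -> exists z, p z = x /\ q z = y].

Lemma gpull_is_pullback X Y Z (f : gmap X Z) (e : gmap Y Z) :
  is_pullback f e (gpull1 f e) (gpull2 f e).
Proof.
split=> [z|z z' z1 z2|x y /eqP xy]; first exact/eqP/(valP z).
  by apply: val_inj; rewrite [val z]surjective_pairing [RHS]surjective_pairing;
     congr pair.
by exists (exist (fun z : gprod X Y => f z.1 == e z.2) (x, y) xy).
Qed.

(** The right leg of [bres p] is an identity, so the only section over a fibre of [bmid f'] is the
    restriction of [bleft f']. *)
Lemma bcomp_bres Y Y' Z (f' : bispan Y' Z) (p : gmap Y' Y) :
  bispan_iso (Bispan (gcomp p (bleft f')) (bmid f') (bright f'))
             (bcomp f' (bres p)).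
Proof.
apply: (bcomp_isoI (f := bres p)
  (h := Bispan (gcomp p (bleft f')) (bmid f') (bright f'))
  (v := gid _) (u1 := gid _) (u2 := bleft f')
  (e := fun b a => if bmid f' a == b then Some (bleft f' a) else None)) => //=.
- move=> b a g; rewrite gmapJ (inj_eq (@gact_inj _ _ g)).
  by case: ifP => //=; rewrite gmapJ.
- by move=> b a; case: ifP => // _; rewrite eqxx.
- move=> b s sP; exists b; split=> // a; have := sP a.
  by case: (s a) => [c /andP[-> /eqP->]|/negPf->].
- by move=> x; rewrite eqxx.
- by move=> b a' a; case: eqP => // <- [<-]; exists a'.
Qed.

(** The middle map of [bspan s] is an identity with one-point fibres, so a section is a single
    element of [btgt f], and composition reduces to two successive base changes. *)
Lemma bcomp_bspan X Y Z (s : span Y Z) (f : bispan X Y) (A' B' : gset gT)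
    (alpha : gmap A' (bsrc f)) (mu : gmap A' B') (beta : gmap B' (btgt f))
    (rho : gmap B' (sapex s)) :
  is_pullback (bright f) (sleft s) beta rho ->
  is_pullback (bmid f) beta alpha mu ->
  bispan_iso (Bispan (gcomp (bleft f) alpha) mu (gcomp (sright s) rho))
             (bcomp (bspan s) f).
Proof.
move=> [pb1c pb1i pb1s] [pb2c pb2i pb2s].
apply: (bcomp_isoI (f := f) (f' := bspan s)
  (h := Bispan (gcomp (bleft f) alpha) mu (gcomp (sright s) rho))
  (v := rho) (u1 := gcomp rho mu) (u2 := alpha)
  (e := fun b w => if w == rho b then Some (beta b) else None)) => //=.
- move=> b a g; rewrite gmapJ (inj_eq (@gact_inj _ _ g)).
  by case: ifP => //=; rewrite gmapJ.
- by move=> b a; case: eqP => [->|]; rewrite ?eqxx ?pb1c //= => /eqP.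
- move=> b b' vb /(_ (rho b)); rewrite vb eqxx => -[eb].
  exact: pb1i.
- move=> w t tP; have := tP w; case tw: (t w) => [c|]; rewrite eqxx //=.
  move=> /eqP/pb1s[b [bc bw]]; exists b; split=> // w'; rewrite bc bw.
  by case: eqP => [->//|/eqP nw]; have := tP w'; case: (t w') => // c'; rewrite (negPf nw).
- by move=> x; rewrite eqxx pb2c.
- by move=> x y xy _ a_xy; exact: pb2i.
- by move=> b w a; case: eqP => // -> [/esym/pb2s[x [<- <-]]]; exists x.
Qed.

Lemma bcomp_btr X Y Z (r : gmap Y Z) (f : bispan X Y) :
  bispan_iso (Bispan (bleft f) (bmid f) (gcomp r (bright f))) (bcomp (btr r) f).
Proof.
apply: (@bcomp_bspan _ _ _ (str r) f _ _ (gid _) (bmid f) (gid _) (bright f)).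
  by split=> //= x y <-; exists x.
by split=> //= x y <-; exists x.
Qed.

(* The dependent product of Z + W along the fold map of Z is W, evaluated by
   z |-> inl z on the first copy of Z and by w on the second. *)
Lemma bcomp_bnm_fold Z W (k : gmap W Z) :
  bispan_iso (Bispan (gsummap k (gid W)) (gfold W) k)
             (bcomp (bnm (gfold Z)) (btr (gsummap (gid Z) k))).
Proof.
apply: (bcomp_isoI (f := btr (gsummap (gid Z) k)) (f' := bnm (gfold Z))
  (h := Bispan (gsummap k (gid W)) (gfold W) k)
  (v := k) (u1 := gsummap k k) (u2 := gsummap k (gid W))
  (e := fun (w : W) (a : gsum Z Z) => match a with
        | inl z => if z == k w then Some (inl z : gsum Z W) else None
        | inr z => if z == k w then Some (inr w : gsum Z W) else None end)) => //=.
- by move=> b [] z g; rewrite /gact /= -!/(gact _ _) gmapJ (inj_eq (@gact_inj _ _ g));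
     case: ifP.
- by move=> b [] z /=; case: eqP => [->|]; rewrite ?eqxx // => /eqP.
- by move=> b b' vb /(_ (inr (k b))); rewrite vb eqxx => -[].
- move=> z s sP; have := sP (inr z); case sz: (s _) => [[z'|w]|] //=; rewrite eqxx //=.
  move=> /eqP [kw]; exists w; split=> // -[] z'; rewrite kw.
    have := sP (inl z'); case: (s (inl z')) => [[z''|w']|] /=.
    + by case/andP=> -> /eqP[->].
    + by case/andP.
    + by move/negPf->.
  have [->|nz] := eqVneq z' z; first by rewrite sz.
  by have := sP (inr z'); case: (s _) => //= a; rewrite (negPf nz).
- by case=> w; rewrite /= eqxx.
- by case=> w [] w' //= ->.
- by move=> b [] z a; case: eqP => // -> [<-]; [exists (inl b) | exists (inr b)].
Qed.

End BispanIso.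

(** * Tambara functors *)

Section TambaraMaps.
Variables (gT : finGroupType) (T : tambara gT).
Implicit Types X Y Z W : gset gT.

Definition tres X Y (f : gmap X Y) : T Y -> T X := tb_map (bres f).
Definition ttr X Y (f : gmap X Y) : T X -> T Y := tb_map (btr f).
Definition tnm X Y (f : gmap X Y) : T X -> T Y := tb_map (bnm f).

Lemma bispan_eq1 X Y (A B : gset gT) (p p' : gmap A X) (q q' : gmap A B)
    (r r' : gmap B Y) : p =1 p' -> q =1 q' -> r =1 r' ->
  bispan_iso (Bispan p q r) (Bispan p' q' r').
Proof.
move=> pE qE rE; apply: (@bispan_isoI _ _ _ (Bispan p q r) (Bispan p' q' r')
  (gid _) (gid _)) => //= b; by exists b.
Qed.

Lemma tres_eq1 X Y (f g : gmap X Y) x : f =1 g -> tres f x = tres g x.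
Proof. by move=> fg; apply: tb_iso; exact: bispan_eq1. Qed.

Lemma ttr_eq1 X Y (f g : gmap X Y) x : f =1 g -> ttr f x = ttr g x.
Proof. by move=> fg; apply: tb_iso; exact: bispan_eq1. Qed.

Lemma tres_comp X Y Z (f : gmap X Y) (g : gmap Y Z) x :
  tres f (tres g x) = tres (gcomp g f) x.
Proof. by rewrite /tres -[LHS]tb_comp -(tb_iso (bcomp_bres _ _)). Qed.

Lemma ttr_comp X Y Z (f : gmap X Y) (g : gmap Y Z) x :
  ttr g (ttr f x) = ttr (gcomp g f) x.
Proof. by rewrite /ttr -[LHS]tb_comp -(tb_iso (bcomp_btr _ _)). Qed.

Lemma tres_id X x : tres (gid X) x = x.
Proof. exact: tb_id. Qed.

Lemma ttr_id X x : ttr (gid X) x = x.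
Proof. exact: tb_id. Qed.

Lemma tb_mapE X Y A B (p : gmap A X) (q : gmap A B) (r : gmap B Y) x :
  tb_map (Bispan p q r) x = ttr r (tnm q (tres p x)).
Proof.
rewrite /ttr /tnm /tres -[tb_map (bnm q) _]tb_comp -(tb_iso (bcomp_bres _ _)).
rewrite -[RHS]tb_comp -(tb_iso (bcomp_btr _ _)).
by apply: tb_iso; exact: bispan_eq1.
Qed.

Lemma tnm_id X x : tnm (gid X) x = x.
Proof. exact: tb_id. Qed.

Lemma tb_map_span X Y (s : span X Y) x :
  tb_map (bspan s) x = ttr (sright s) (tres (sleft s) x).
Proof. by rewrite tb_mapE tnm_id. Qed.

Lemma tres_ttr X Y Z P (f : gmap X Z) (g : gmap Y Z) (p : gmap P X)
    (q : gmap P Y) x :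
  is_pullback f g p q -> tres g (ttr f x) = ttr q (tres p x).
Proof.
move=> pb; rewrite /tres /ttr -[LHS]tb_comp -[RHS]tb_comp.
rewrite -(tb_iso (@bcomp_bspan _ _ _ _ (sres g) (btr f) _ _ p (gid _) p q _ _)) //.
  by rewrite -(tb_iso (bcomp_btr _ _)); apply: tb_iso; exact: bispan_eq1.
by split=> //= a b ->; exists b.
Qed.

Lemma tres_tnm X Y Z P (f : gmap X Z) (g : gmap Y Z) (p : gmap P X)
    (q : gmap P Y) x :
  is_pullback f g p q -> tres g (tnm f x) = tnm q (tres p x).
Proof.
move=> pb; rewrite /tres /tnm -[LHS]tb_comp -[RHS]tb_comp.
rewrite -(tb_iso (@bcomp_bspan _ _ _ _ (sres g) (bnm f) _ _ p q g (gid _) _ _)) //.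
  by rewrite -(tb_iso (bcomp_bres _ _)); apply: tb_iso; exact: bispan_eq1.
by split=> //= a b ->; exists b.
Qed.

(** Turns a statement about two elements into one about a single element over a disjoint union,
    where sum and product are transfer and norm along the fold map. *)
Lemma tpair X Y (x : T X) (y : T Y) :
  exists z, tres (ginl X Y) z = x /\ tres (ginr X Y) z = y.
Proof.
have [h _ hK] := @tb_product _ T X Y.
by exists (h (x, y)); have [] := hK (x, y).
Qed.

Lemma ttr_fold Y z :
  ttr (gfold Y) z = tres (ginl Y Y) z + tres (ginr Y Y) z.
Proof. exact: tb_add. Qed.

Lemma tnm_fold Y z :
  tnm (gfold Y) z = tres (ginl Y Y) z * tres (ginr Y Y) z.
Proof. exact: tb_mul. Qed.

(** With base change for transfers and norms, this makes restriction additive and multiplicative. *)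
Lemma gfold_pullback X Y (f : gmap X Y) :
  is_pullback (gfold Y) f (gsummap f f) (gfold X).
Proof.
split=> [[]|[] x [] y //= _ ->|[] y x /= ->] //.
  by exists (inl x).
by exists (inr x).
Qed.

Lemma tres_summap_l X X' Y Y' (f : gmap X X') (g : gmap Y Y') z :
  tres (ginl X Y) (tres (gsummap f g) z) = tres f (tres (ginl X' Y') z).
Proof. by rewrite !tres_comp; exact: tres_eq1. Qed.

Lemma tres_summap_r X X' Y Y' (f : gmap X X') (g : gmap Y Y') z :
  tres (ginr X Y) (tres (gsummap f g) z) = tres g (tres (ginr X' Y') z).
Proof. by rewrite !tres_comp; exact: tres_eq1. Qed.

Lemma tresD X Y (f : gmap X Y) x y : tres f (x + y) = tres f x + tres f y.
Proof.
have [z [<- <-]] := tpair x y.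
rewrite -ttr_fold (tres_ttr _ (gfold_pullback f)) ttr_fold.
by rewrite tres_summap_l tres_summap_r.
Qed.

Lemma tresM X Y (f : gmap X Y) x y : tres f (x * y) = tres f x * tres f y.
Proof.
have [z [<- <-]] := tpair x y.
rewrite -tnm_fold (tres_tnm _ (gfold_pullback f)) tnm_fold.
by rewrite tres_summap_l tres_summap_r.
Qed.

Lemma tnm_init Y z : tnm (ginit Y) z = 1.
Proof. exact: tb_one. Qed.

Lemma ttr_init Y z : ttr (ginit Y) z = 0.
Proof. exact: tb_zero. Qed.

Lemma tres1 X Y (f : gmap X Y) : tres f 1 = 1.
Proof.
rewrite -(tnm_init _ 0) (@tres_tnm _ _ _ _ _ _ (gid _) (ginit X)) ?tnm_init //.
Qed.

Lemma tresB X Y (f : gmap X Y) : {morph tres f : x y / x - y}.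
Proof.
by move=> x y; apply: (addIr (tres f y)); rewrite -tresD !subrK.
Qed.

Lemma ttr_case X Y Z (f : gmap X Z) (g : gmap Y Z) z :
  ttr (gcase f g) z = ttr f (tres (ginl X Y) z) + ttr g (tres (ginr X Y) z).
Proof.
have -> : ttr (gcase f g) z = ttr (gfold Z) (ttr (gsummap f g) z).
  by rewrite ttr_comp; apply: ttr_eq1; case.
rewrite ttr_fold (@tres_ttr _ _ _ _ _ _ (ginl X Y) f); last first.
  by split=> [//|x x' []//|[] x y //= [<-]]; exists x.
rewrite (@tres_ttr _ _ _ _ _ _ (ginr X Y) g) //.
by split=> [//|x x' []//|[] x y //= [<-]]; exists x.
Qed.

Lemma ttrD X Y (f : gmap X Y) x y : ttr f (x + y) = ttr f x + ttr f y.
Proof.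
have [z [<- <-]] := tpair x y.
by rewrite -ttr_fold ttr_comp -ttr_case; apply: ttr_eq1; case.
Qed.

Lemma ttrB X Y (f : gmap X Y) : {morph ttr f : x y / x - y}.
Proof.
by move=> x y; apply: (addIr (ttr f y)); rewrite -ttrD !subrK.
Qed.

(** The left side is the norm along the fold map of [Z] of a transfer along [gsummap (gid Z) f]. The
    exponential diagram of [bcomp_bnm_fold] rewrites it as a transfer along [f] of a norm along the
    fold map of [W]. *)
Lemma frobenius Z W (f : gmap W Z) x y : x * ttr f y = ttr f (tres f x * y).
Proof.
have [z [<- <-]] := tpair x y.
have zl : tres (ginl Z Z) (ttr (gsummap (gid Z) f) z) = tres (ginl Z W) z.
  rewrite (@tres_ttr _ _ _ _ _ _ (ginl Z W) (gid Z)) ?ttr_id //.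
  by split=> [//|a b []//|[] a b //= [<-]]; exists a.
have zr : tres (ginr Z Z) (ttr (gsummap (gid Z) f) z) = ttr f (tres (ginr Z W) z).
  rewrite (@tres_ttr _ _ _ _ _ _ (ginr Z W) f) //.
  by split=> [//|a b []//|[] a b //= [<-]]; exists a.
rewrite -zl -zr -tnm_fold -[LHS]tb_comp.
rewrite -(tb_iso (bcomp_bnm_fold f)) [LHS]tb_mapE tnm_fold.
by rewrite tres_summap_l tres_summap_r tres_id zl.
Qed.

Lemma ttr_bij X Y Z (u : gmap X Y) (f : gmap Y Z) y :
  injective u -> (forall b, exists a, u a = b) ->
  ttr f y = ttr (gcomp f u) (tres u y).
Proof.
move=> u_inj u_surj; rewrite -(tb_map_span (Span u (gcomp f u))).
apply/esym; apply: tb_iso.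
exact: (@bispan_isoI _ _ _ (bspan (Span u (gcomp f u))) (btr f) u u).
Qed.

HB.instance Definition _ X Y (f : gmap X Y) :=
  GRing.isZmodMorphism.Build (T Y) (T X) (tres f) (tresB f).
HB.instance Definition _ X Y (f : gmap X Y) :=
  GRing.isMonoidMorphism.Build (T Y) (T X) (tres f)
    (tres1 f, tresM f).
HB.instance Definition _ X Y (f : gmap X Y) :=
  GRing.isZmodMorphism.Build (T X) (T Y) (ttr f) (ttrB f).

End TambaraMaps.

Section TambaraHom.
Variables (gT : finGroupType) (S T : tambara gT) (h : tambara_hom S T).
Implicit Types X Y : gset gT.

Lemma th_tres X Y (f : gmap X Y) y : h X (tres f y) = tres f (h Y y).
Proof. exact: th_nat. Qed.

Lemma th_ttr X Y (f : gmap X Y) x : h Y (ttr f x) = ttr f (h X x).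
Proof. exact: th_nat. Qed.

Lemma th_tnm X Y (f : gmap X Y) x : h Y (tnm f x) = tnm f (h X x).
Proof. exact: th_nat. Qed.

Lemma thD Y : {morph h Y : x y / x + y}.
Proof.
move=> x y; have [z [<- <-]] := tpair x y.
by rewrite -ttr_fold th_ttr ttr_fold -!th_tres.
Qed.

Lemma thM Y : {morph h Y : x y / x * y}.
Proof.
move=> x y; have [z [<- <-]] := tpair x y.
by rewrite -tnm_fold th_tnm tnm_fold -!th_tres.
Qed.

Lemma th1 Y : h Y 1 = 1.
Proof. by rewrite -(tnm_init _ 0) th_tnm tnm_init. Qed.

Lemma thB Y : {morph h Y : x y / x - y}.
Proof. by move=> x y; apply: (addIr (h Y y)); rewrite -thD !subrK. Qed.

HB.instance Definition _ Y := GRing.isZmodMorphism.Build (S Y) (T Y) (h Y) (@thB Y).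
HB.instance Definition _ Y :=
  GRing.isMonoidMorphism.Build (S Y) (T Y) (h Y) (th1 Y, @thM Y).

End TambaraHom.

(** * Box products *)

Section SubMackey.
Variables (gT : finGroupType) (S : tambara gT) (N : forall Y : gset gT, S Y -> Prop).
Implicit Types X Y Z : gset gT.
Hypotheses (N0 : forall Y, N (0 : S Y))
  (NB : forall Y (y y' : S Y), N y -> N y' -> N (y - y'))
  (Nres : forall X Y (f : gmap X Y) y, N y -> N (tres f y))
  (Ntr : forall X Y (f : gmap X Y) x, N x -> N (ttr f x)).

(** Made boolean by classical logic, so that the subtype inherits a group structure. *)
Definition submk_pred Y : pred (S Y) := fun y => `[< N y >].

Fact submk_zmod_closed Y : zmod_closed (@submk_pred Y).
Proof.
split=> [|y y' /asboolP Ny /asboolP Ny']; apply/asboolP; first exact: N0.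
exact: NB.
Qed.
HB.instance Definition _ Y :=
  GRing.isZmodClosed.Build (S Y) (@submk_pred Y) (@submk_zmod_closed Y).

Definition submk Y := {y : S Y | submk_pred y}.
HB.instance Definition _ Y := SubChoice.on (submk Y).
HB.instance Definition _ Y := [SubChoice_isSubZmodule of submk Y by <:].

Fact submk_map_subproof X Y (s : span X Y) (x : submk X) :
  submk_pred (tb_map (bspan s) (val x)).
Proof.
by apply/asboolP; rewrite tb_map_span; apply/Ntr/Nres/asboolP/(valP x).
Qed.

Definition submk_map X Y (s : span X Y) (x : submk X) : submk Y :=
  exist _ (tb_map (bspan s) (val x)) (submk_map_subproof s x).

Fact submk_iso X Y (s s' : span X Y) :
  span_iso s s' -> submk_map s =1 submk_map s'.
Proof.
by move=> ss' x; apply: val_inj; exact: (mk_iso (m := underlying_mackey S)).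
Qed.

Fact submk_id X : submk_map (sid X) =1 id.
Proof. by move=> x; apply: val_inj; exact: (mk_id (m := underlying_mackey S)). Qed.

Fact submk_comp X Y Z (s' : span Y Z) (s : span X Y) :
  submk_map (scomp s' s) =1 submk_map s' \o submk_map s.
Proof.
by move=> x; apply: val_inj; exact: (mk_comp (m := underlying_mackey S)).
Qed.

Fact submk_terminal (z z' : submk (gempty gT)) : z = z'.
Proof. exact/val_inj/tb_terminal. Qed.

(** The inverse adds the transfers along the two inclusions, which stays in [N]; it is an inverse
    because the two composites of restriction and transfer sum to the identity. *)
Fact submk_product X Y :
  bijective (fun z => (submk_map (sres (ginl X Y)) z,
                       submk_map (sres (ginr X Y)) z)).
Proof.
have ok (u : submk X * submk Y) :
    submk_pred (ttr (ginl X Y) (val u.1) + ttr (ginr X Y) (val u.2)).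
  have N1 : N (ttr (ginl X Y) (val u.1)) by apply/Ntr/asboolP; exact: (valP u.1).
  have N2 : N (ttr (ginr X Y) (val u.2)) by apply/Ntr/asboolP; exact: (valP u.2).
  apply/asboolP; rewrite -[X in _ + X]opprK; apply: NB => //.
  by rewrite -sub0r; exact: NB.
have split_eq (z : S (gsum X Y)) :
    ttr (ginl X Y) (tres (ginl X Y) z) + ttr (ginr X Y) (tres (ginr X Y) z) = z.
  by rewrite -ttr_case -[RHS]ttr_id; apply: ttr_eq1; case.
exists (fun u => exist (@submk_pred (gsum X Y)) _ (ok u)) => [z|[x y]].
  exact/val_inj/split_eq.
have [z [zl zr]] := tpair (val x) (val y).
by congr pair; apply: val_inj => /=; rewrite -/(tres _ _) -?zl -?zr split_eq.
Qed.

Fact submk_zero Y z : submk_map (str (ginit Y)) z = 0.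
Proof. by apply: val_inj; exact: (mk_zero (m := underlying_mackey S)). Qed.

Fact submk_add Y z :
  submk_map (str (gfold Y)) z
  = submk_map (sres (ginl Y Y)) z + submk_map (sres (ginr Y Y)) z.
Proof. by apply: val_inj; exact: (mk_add (m := underlying_mackey S)). Qed.

Definition sub_mackey : mackey gT :=
  @Mackey gT (fun Y => submk Y) submk_map submk_iso submk_id submk_comp
    submk_terminal submk_product submk_zero submk_add.

End SubMackey.

(** * Generation of a box product by its pairing *)

Section BoxGenerated.
Variables (gT : finGroupType) (T U S : tambara gT).
Variables (i : tambara_hom T S) (j : tambara_hom U S).
Implicit Types X Y Z W : gset gT.
Hypothesis box : box_product i j.

(* By the uniqueness part of the universal property, a sub-Mackey functor
   through which the pairing factors is everything. *)
Lemma box_ind (N : forall Y, S Y -> Prop) :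
  (forall Y, N Y 0) ->
  (forall Y y y', N Y y -> N Y y' -> N Y (y - y')) ->
  (forall X Y (f : gmap X Y) y, N Y y -> N X (tres f y)) ->
  (forall X Y (f : gmap X Y) x, N X x -> N Y (ttr f x)) ->
  (forall Y t u, N Y (i Y t * j Y u)) ->
  forall Y y, N Y y.
Proof.
move=> N0 NB Nres Ntr Nij Y y.
case: box => -[tDl tDr tN] univ.
pose pr X Z (t : T X) (u : U Z) : S (gprod X Z) :=
  tres (gfst X Z) (i X t) * tres (gsnd X Z) (j Z u).
(* Since [i] and [j] commute with restriction, the external product is an internal one, [i] of a
   restriction times [j] of a restriction. *)
have prN X Z t u : submk_pred N (pr X Z t u).
  by apply/asboolP; rewrite /pr -!th_tres; exact: Nij.
pose P := sub_mackey N0 NB Nres Ntr.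
pose p X Z (t : T X) (u : U Z) : P (gprod X Z) :=
  exist (submk_pred N (Y := gprod X Z)) (pr X Z t u) (prN X Z t u).
have [|h [hE _]] := univ P p.
  split=> [X Z t t' u|X Z t u u'|X X' Z Z' f e t u]; apply: val_inj.
  - exact: tDl.
  - exact: tDr.
  - exact: tN.
have hN X Z (f : span X Z) (x : S X) :
    val (h Z (mk_map (m := underlying_mackey S) f x))
    = mk_map (m := underlying_mackey S) f (val (h X x)).
  by rewrite mh_nat.
have idN X Z (f : span X Z) (x : S X) :
    mk_map (m := underlying_mackey S) f x = mk_map (m := underlying_mackey S) f x.
  by [].
have [h0 [_ h0E]] := univ (underlying_mackey S) pr (And3 tDl tDr tN).
pose h1 : mackey_hom (underlying_mackey S) (underlying_mackey S) :=
  @MackeyHom gT (underlying_mackey S) (underlying_mackey S) _ hN.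
pose h2 : mackey_hom (underlying_mackey S) (underlying_mackey S) :=
  @MackeyHom gT (underlying_mackey S) (underlying_mackey S) (fun Z x => x) idN.
(* The inclusion after [h], which is [h1], and the identity [h2] both carry the pairing to itself,
   so both equal [h0]. *)
have <- : h1 Y y = y.
  rewrite (h0E h1) -?(h0E h2) // => X Z t u /=.
  by rewrite hE.
by apply/asboolP; exact: (valP (h Y y)).
Qed.

(** One term is enough because [W] is an arbitrary finite G-set: a difference of two terms is a term
    over the disjoint union. Base change handles restrictions, composition handles transfers. *)
Lemma box_gen Z (z : S Z) :
  exists W (f : gmap W Z) (t : T W) (u : U W), z = ttr f (i W t * j W u).
Proof.
move: Z z; apply: box_ind.
- by move=> Y; exists (gempty gT), (ginit Y), 0, 0; rewrite ttr_init.
- move=> Y _ _ [W [f [t [u ->]]]] [W' [f' [t' [u' ->]]]].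
  (* The sign of the second term is absorbed into its [T]-factor. *)
  have [t2 [t2l t2r]] := tpair t (- t'); have [u2 [u2l u2r]] := tpair u u'.
  exists (gsum W W'), (gcase f f'), t2, u2.
  rewrite ttr_case !tresM -!th_tres t2l t2r u2l u2r.
  by rewrite rmorphN mulNr raddfN.
- move=> X Y g _ [W [f [t [u ->]]]].
  exists (gpull f g), (gpull2 f g), (tres (gpull1 f g) t), (tres (gpull1 f g) u).
  by rewrite (tres_ttr _ (gpull_is_pullback f g)) tresM !th_tres.
- move=> X Y g _ [W [f [t [u ->]]]].
  by exists W, (gcomp g f), t, u; rewrite ttr_comp.
- by move=> Y t u; exists Y, (gid Y), t, u; rewrite ttr_id.
Qed.

End BoxGenerated.

(** * Decomposition of transfers into orbits *)

Section Orbits.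
Variables (gT : finGroupType) (L : {group gT}) (W : gset gT).

Lemma gorb_unit_subproof : (L : {set gT}) \in rcosets L [set: gT].
Proof. by apply/rcosetsP; exists 1%g; rewrite ?inE // rcoset1. Qed.

Definition gorb_unit : gorb L :=
  exist (fun C : gsets gT => C \in rcosets L [set: gT]) (L : {set gT})
    gorb_unit_subproof.

Lemma val_gorb_unit_act g : val (gorb_unit *^ g) = (L :* g)%g.
Proof. by rewrite /= /gact /= rcosetE. Qed.

Lemma gorbP (C : gorb L) : exists g, C = gorb_unit *^ g.
Proof.
case: C => C CP; have /rcosetsP[g _ Cg] := CP; exists g; apply: val_inj.
by rewrite val_gorb_unit_act.
Qed.

Lemma gorb_unit_fix g : gorb_unit *^ g = gorb_unit -> g \in L.
Proof.
move=> /(congr1 val); rewrite val_gorb_unit_act => /= Lg.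
by rewrite -Lg; apply/rcosetP; exists 1%g; rewrite ?mul1g.
Qed.

Lemma val_gorb_repr (C : gorb L) : (L :* repr (val C))%g = val C.
Proof. by have /rcosetsP[g _ ->] := valP C; rewrite rcoset_repr. Qed.

(** [repr] picks some representative of the coset; as [L] fixes [w], the translate of [w] does not
    depend on the choice. *)
Lemma gorb_orbit_subproof (w : W) :
  (forall g, g \in L -> w *^ g = w) ->
  forall (C : gorb L) g, w *^ repr (val (C *^ g)) = w *^ repr (val C) *^ g.
Proof.
move=> wL C g; rewrite -gactM.
have CgE : val (C *^ g) = (L :* (repr (val C) * g))%g.
  by rewrite /= /gact /= rcosetE -[in LHS]val_gorb_repr rcosetM.
rewrite [val (C *^ g)]CgE; have /rcosetP[x xL ->] := mem_repr_rcoset L (repr (val C) * g)%g.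
by rewrite (gactM w x) wL ?(gactM w).
Qed.

Definition gorb_orbit (w : W) (wL : forall g, g \in L -> w *^ g = w) :
  gmap (gorb L) W := GMap (gorb_orbit_subproof wL).

End Orbits.

Section OrbitInduction.
Variables (gT : finGroupType) (S : tambara gT) (L : {group gT}).
Variables (P : forall Y, S Y -> Prop) (N : S (gorb L) -> Prop).
Hypotheses (Pres : forall X Y (f : gmap X Y) y, P y -> P (tres f y))
  (N0 : N 0) (ND : forall x y, N x -> N y -> N (x + y))
  (Ntr : forall (H : {group gT}) (sHL : H \subset L) y, P y ->
     N (ttr (gproj sHL) y)).

(** Induction on the cardinality of [W]: splitting off the orbit of one point leaves a transfer
    along some [gproj], covered by [Ntr], and a transfer from a smaller set. *)
Lemma ttr_orbits W (f : gmap W (gorb L)) y : P y -> N (ttr f y).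
Proof.
have [n] := ubnP #|W|; elim: n => // n IH in W f y * => ltWn Py.
have [w0 _|W0] := pickP (fun _ : W => true); last first.
  rewrite (@ttr_bij _ _ _ _ _ (ginit W) f) => [|[]//|w]; last by have := W0 w.
  rewrite (@ttr_eq1 _ _ _ _ _ (ginit (gorb L))) ?ttr_init //; by case.
have [g0 fw0] := gorbP (f w0).
(* This point of the orbit lies over the unit coset, so its stabiliser is contained in [L]. *)
pose w := w0 *^ g0^-1%g.
have fw : f w = gorb_unit L by rewrite /w gmapJ fw0 gactK.
pose Hset := [set g | w *^ g == w].
have HG : group_set Hset.
  apply/group_setP; split=> [|x z]; rewrite !inE; first by rewrite gact1.
  by move=> /eqP xw /eqP zw; rewrite (gactM w) xw zw.
pose H := Group HG.
have wH g : g \in H -> w *^ g = w by rewrite inE => /eqP.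
have sHL : H \subset L.
  by apply/subsetP => g /wH gw; apply: gorb_unit_fix; rewrite -fw -gmapJ gw.
pose o := gorb_orbit wH.
have oJ x g : x \notin codom o -> x *^ g \notin codom o.
  apply: contraNN => /codomP[C oC]; apply/codomP; exists (C *^ g^-1%g).
  by rewrite gmapJ -oC gactK.
pose u := gcase o (gsub_val oJ).
have o_inj : injective o.
  move=> C C' /= eqCC'; apply: val_inj.
  apply: etrans (esym (val_gorb_repr C)) _.
  apply: etrans _ (val_gorb_repr C'); apply/rcoset_eqP.
  rewrite mem_rcoset inE (gactM w) eqCC'.
  by rewrite -gactM mulgV gact1.
have u_inj : injective u.
  case=> [C|x] [C'|x'] /=; first by move/o_inj->.
  - by move=> oC; case/negP: (valP x'); apply/codomP; exists C; exact: esym oC.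
  - by move=> oC; case/negP: (valP x); apply/codomP; exists C'; exact: oC.
  - by move/val_inj->.
have u_surj x : exists a, u a = x.
  have [/codomP[C ->]|nx] := boolP (x \in codom o); first by exists (inl C).
  by exists (inr (exist (fun x => x \notin codom o) x nx)).
rewrite (ttr_bij f y u_inj u_surj).
rewrite (@ttr_eq1 _ _ _ _ _ (gcase (gproj sHL) (gcomp f (gsub_val oJ)))); last first.
  case=> //= C; rewrite gmapJ fw; apply: val_inj.
apply: etrans (val_gorb_unit_act L _) _ => /=.
  by rewrite -[in RHS](val_gorb_repr (L := H) C) mulgA mulGSid.
rewrite ttr_case !tres_comp; apply: ND; first exact/Ntr/Pres.
apply: IH; last exact: Pres.
rewrite -ltnS (leq_trans _ ltWn) // ltnS card_sub.
(* The complement of the orbit misses [w], hence is strictly smaller than [W]. *)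
have wo : w \notin [predC codom o].
  rewrite negbK; apply/codomP; exists (gorb_unit H).
  by apply/esym/wH; exact: (mem_repr 1%g (group1 H)).
apply: (leq_trans (n := #|[pred x | x != w]|.+1)).
  rewrite ltnS; apply: subset_leq_card; apply/subsetP => x.
  by rewrite !inE; apply: contraNneq => ->; move: wo; rewrite negbK.
by rewrite -(cardC (pred1 w)) card1.
Qed.

End OrbitInduction.

(** * Elementary symmetric functions as bispans *)

Section Pow.
Variable gT : finGroupType.

Definition gpow (B : gset gT) : gset gT := GSet ((gset_act B)^*)%act.

Lemma mem_gpow (B : gset gT) (S : gpow B) (b : B) g :
  (b *^ g \in (S *^ g : gpow B)) = (b \in (S : {set B})).
Proof. exact/mem_imset/gact_inj. Qed.

Lemma mem_gpowV (B : gset gT) (S : gpow B) (b : B) g :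
  (b \in (S *^ g : gpow B)) = (b *^ g^-1%g \in (S : {set B})).
Proof. by rewrite -(mem_gpow S _ g) gactKV. Qed.

Lemma card_gpow (B : gset gT) (S : gpow B) g :
  #|((S *^ g : gpow B) : {set B})| = #|(S : {set B})|.
Proof. exact/card_imset/gact_inj. Qed.

Lemma gpowU1 (B : gset gT) (b : B) (S : {set B}) g :
  (((b |: S)%SET : gpow B) *^ g : gpow B)
  = (b *^ g |: ((S : gpow B) *^ g : gpow B))%SET.
Proof.
apply/setP=> c; rewrite mem_gpowV !inE mem_gpowV.
by rewrite (can2_eq (@gactKV _ B g) (@gactK _ B g)).
Qed.

Section Bpow.
Variables (X Y W : gset gT) (f : bispan X Y).
Variables (P : pred (gprod W (gpow (btgt f)))).
Hypothesis PJ : forall z g, P z -> P (z *^ g).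

Definition bpow_tgt := gsub PJ.

(** The fibre over [(w, S)] is the union of the fibres of [bmid f] over the points of [S]; thus
    [(w, S)] stands for the product of the monomials of [f] indexed by [S]. *)
Definition bpow_in (z : gprod bpow_tgt (bsrc f)) : bool :=
  bmid f z.2 \in ((val z.1).2 : {set btgt f}).

Fact bpow_inJ z g : bpow_in z -> bpow_in (z *^ g).
Proof. by rewrite /bpow_in /= gmapJ mem_gpow. Qed.

Definition bpow : bispan X W :=
  Bispan (gcomp (bleft f) (gcomp (gsnd _ _) (gsub_val bpow_inJ)))
         (gcomp (gfst _ _) (gsub_val bpow_inJ))
         (gcomp (gfst _ _) (gsub_val PJ)).

Definition bpow_t w S (h : P (w, S)) : btgt bpow := exist P (w, S) h.
Definition bpow_s (t : btgt bpow) a (h : bpow_in (t, a)) : bsrc bpow :=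
  exist bpow_in (t, a) h.

End Bpow.

Section BpowRes.
Variables (X Y W W' : gset gT) (f : bispan X Y) (p : gmap W' W).
Variables (P : pred (gprod W (gpow (btgt f)))).
Variables (P' : pred (gprod W' (gpow (btgt f)))).
Hypotheses (PJ : forall z g, P z -> P (z *^ g))
  (P'J : forall z g, P' z -> P' (z *^ g))
  (P'E : forall w S, P' (w, S) = P (p w, S)).

Fact bpow_res_subproof (z : btgt (bpow P'J)) : P (p (val z).1, (val z).2).
Proof. by case: z => -[w S] /= h; rewrite -P'E. Qed.

Fact bpow_res_tgtJ (z : btgt (bpow P'J)) g :
  bpow_t PJ (bpow_res_subproof (z *^ g)) = bpow_t PJ (bpow_res_subproof z) *^ g.
Proof. by apply: val_inj; congr pair; rewrite /= gmapJ. Qed.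

Definition bpow_res_tgt : gmap (btgt (bpow P'J)) (btgt (bpow PJ)) :=
  GMap bpow_res_tgtJ.

Fact bpow_res_srcP (z : bsrc (bpow P'J)) :
  bpow_in (bpow_res_tgt (val z).1, (val z).2).
Proof. exact: (valP z). Qed.

Fact bpow_res_srcJ (z : bsrc (bpow P'J)) g :
  bpow_s (bpow_res_srcP (z *^ g)) = bpow_s (bpow_res_srcP z) *^ g.
Proof. by apply: val_inj; congr pair; rewrite /= bpow_res_tgtJ. Qed.

Definition bpow_res_src : gmap (bsrc (bpow P'J)) (bsrc (bpow PJ)) :=
  GMap bpow_res_srcJ.

(** [P'] is [P] pulled back along [p], so both squares required by [bcomp_bspan] are pullbacks. *)
Lemma bpow_res : bispan_iso (bpow P'J) (bcomp (bres p) (bpow PJ)).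
Proof.
suff [u [v [buv lu mu rv]]] : bispan_iso
    (Bispan (gcomp (bleft (bpow PJ)) bpow_res_src) (bmid (bpow P'J))
      (gcomp (sright (sres p)) (bright (bpow P'J)))) (bcomp (bres p) (bpow PJ)).
  by exists u, v.
apply: (@bcomp_bspan _ _ _ _ (sres p) (bpow PJ) _ _
  bpow_res_src (bmid (bpow P'J)) bpow_res_tgt (bright (bpow P'J))).
  split=> [//|[[w S] h] [[w' S'] h'] /= [_ SS'] ww'|[[w S] h] w' /= wE].
    by apply: val_inj; rewrite /= ww' SS'.
  have h' : P' (w', S) by rewrite P'E -wE.
  by exists (bpow_t P'J h'); split=> //; apply: val_inj; rewrite /= wE.
split=> [//|z z' /(congr1 val) [_ _ az] tz|[[t a] ta] t' /= tt'].
  by apply: val_inj; rewrite [val z]surjective_pairing [RHS]surjective_pairing; congr pair.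
have t'a : bpow_in (t', a) by move: ta; rewrite /bpow_in /= tt'.
exists (bpow_s t'a); split=> //; apply: val_inj; congr pair.
by rewrite tt'.
Qed.

End BpowRes.

Section Partial.
Variables (X Y Z : gset gT) (f : bispan X Y) (p : gmap Y Z).
Let B := btgt f.

(* [S] is the graph of a partial section of [bright f], with k values, over the
   fibre of [p] at [z]. *)
Definition psec k z (S : {set B}) : bool :=
  [&& #|S| == k, [forall b in S, p (bright f b) == z] &
      [forall b in S, forall b' in S, (bright f b == bright f b') ==> (b == b')]].

Lemma psecP k z (S : {set B}) :
  reflect [/\ #|S| = k, forall b, b \in S -> p (bright f b) = z &
              {in S &, injective (bright f)}] (psec k z S).
Proof.
apply: (iffP and3P) => -[/eqP Sk Sp Sr]; split=> //.
- by move=> b bS; apply/eqP; exact: (forall_inP Sp).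
- move=> b b' bS b'S rbb'; apply/eqP.
  by have := forall_inP (forall_inP Sr b bS) b' b'S; rewrite rbb' eqxx.
- by apply/forall_inP => b bS; rewrite Sp.
- apply/forall_inP => b bS; apply/forall_inP => b' b'S; apply/implyP => /eqP rbb'.
  by apply/eqP/Sr.
Qed.

Lemma psecJ k z (S : gpow B) g : psec k z S -> psec k (z *^ g) (S *^ g : gpow B).
Proof.
case/psecP=> Sk Sp Sr; apply/psecP; split=> [|b|b b'].
- by rewrite card_gpow.
- by rewrite mem_gpowV => /Sp <-; rewrite !gmapJ gactKV.
- rewrite !mem_gpowV => bS b'S rbb'; apply: (can_inj (@gactKV _ B g)).
  by apply: Sr => //; rewrite !gmapJ rbb'.
Qed.

Definition sec_pred k (z : gprod Z (gpow B)) := psec k z.1 z.2.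
Definition allsec_pred k (z : gprod Y (gpow B)) := psec k (p z.1) z.2.
Definition avoid_pred k (z : gprod Y (gpow B)) :=
  psec k (p z.1) z.2 && [forall b in (z.2 : {set B}), bright f b != z.1].

Fact sec_predJ k z g : sec_pred k z -> sec_pred k (z *^ g).
Proof. exact: psecJ. Qed.

Fact allsec_predJ k z g : allsec_pred k z -> allsec_pred k (z *^ g).
Proof. by rewrite /allsec_pred /= gmapJ; exact: psecJ. Qed.

Fact avoid_predJ k z g : avoid_pred k z -> avoid_pred k (z *^ g).
Proof.
case/andP=> Sk /forall_inP Sz; rewrite /avoid_pred /= gmapJ psecJ //=.
apply/forall_inP => b; rewrite mem_gpowV => /Sz; apply: contraNneq => bz.
by rewrite gmapJ bz gactK.
Qed.

(* For x = eta f: the k-th elementary symmetric function of the conjugates of x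
   over Z, its restriction to Y, and the k-th elementary symmetric function of
   the conjugates other than x itself. *)
Definition besym k : bispan X Z := bpow (@sec_predJ k).
Definition besym_res k : bispan X Y := bpow (@allsec_predJ k).
Definition besym_other k : bispan X Y := bpow (@avoid_predJ k).

Lemma besym_resP k : bispan_iso (besym_res k) (bcomp (bres p) (besym k)).
Proof. exact: bpow_res. Qed.

(** Only the empty set has cardinality 0, so each [y] contributes a single target point with empty
    fibre, the empty product. *)
Lemma besym_other0 : bispan_iso (bone X Y) (besym_other 0).
Proof.
have ok y : avoid_pred 0 (y, set0).
  rewrite /avoid_pred; apply/andP; split; last by apply/forall_inP => b; rewrite inE.
  by apply/psecP; split=> [|b|b]; rewrite ?cards0 // inE.
have vJ (y : Y) g : bpow_t (@avoid_predJ 0) (ok (y *^ g))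
                  = bpow_t (@avoid_predJ 0) (ok y) *^ g.
  by apply: val_inj; congr pair; apply/setP=> b; rewrite mem_gpowV !inE.
have S0 y S : avoid_pred 0 (y, S) -> S = set0.
  by case/andP=> /psecP[/cards0_eq].
apply: (@bispan_isoI _ _ _ (bone X Y) (besym_other 0) (ginit _)
  (@GMap _ (btgt (bone X Y)) _ _ vJ)) => /=.
- by case.
- case=> -[[[y S] h] a] aS; exfalso; have := aS.
  by rewrite /bpow_in /= (S0 y S h) inE.
- by move=> y y' /(congr1 val) [].
- case=> -[y S] h; exists y; apply: val_inj => /=; congr pair.
  by rewrite (S0 y S h).
- by case.
- by case.
- by [].
Qed.

Lemma besym_other_big k : (#|B| < k)%N -> bispan_iso (bzero X Y) (besym_other k).
Proof.
move=> ltBk; have no (t : btgt (besym_other k)) : False.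
  case: t => -[y S] /= /andP[/psecP[Sk _ _] _]; move: ltBk.
  by rewrite -Sk ltnNge max_card.
apply: (@bispan_isoI _ _ _ (bzero X Y) (besym_other k) (ginit _) (ginit _)) => /=.
- by case.
- by move=> [[t a] ta]; case: (no t).
- by case.
- by move=> t; case: (no t).
- by case.
- by case.
- by case.
Qed.

Section Split.
Variable k : nat.
Let F := besym_other k.
Let F1 := besym_other k.+1.
Let E := besym_res k.+1.
Let D := badd F1 (bmul f F).

Lemma avoid_notin y (S : {set B}) b :
  avoid_pred k (y, S) -> bright f b = y -> b \notin S.
Proof.
case/andP=> _ /forall_inP Sy bz; apply: contraTN isT => /Sy /=.
by rewrite bz eqxx.
Qed.

Lemma allsecU1 y (S : {set B}) b :
  avoid_pred k (y, S) -> bright f b = y -> allsec_pred k.+1 (y, (b |: S)%SET).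
Proof.
move=> yS bz; have bS := avoid_notin yS bz; move: yS.
case/andP=> /psecP[/= Sk Sp Sr] /forall_inP Sy; apply/psecP; split=> /= [|c|c c'].
- by rewrite cardsU1 bS Sk.
- by case/setU1P=> [->|/Sp//]; rewrite bz.
- case/setU1P=> [->|cS] /setU1P[->|c'S] //.
  + by move=> cc'; have := Sy c' c'S; rewrite -cc' bz eqxx.
  + by move=> cc'; have := Sy c cS; rewrite cc' bz eqxx.
  + exact: Sr.
Qed.

Lemma avoid_allsec y (S : {set B}) :
  avoid_pred k.+1 (y, S) -> allsec_pred k.+1 (y, S).
Proof. by case/andP. Qed.

Lemma avoidD1 y (S : {set B}) b : allsec_pred k.+1 (y, S) -> b \in S ->
  bright f b = y -> avoid_pred k (y, (S :\ b)%SET).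
Proof.
case/psecP=> /= Sk Sp Sr bS bz; apply/andP; split; last first.
  apply/forall_inP => c /setD1P[cb cS]; apply: contraNneq cb => /= cy.
  by apply/eqP/Sr; rewrite // bz.
apply/psecP; split=> /= [|c /setD1P[_ /Sp]//|c c' /setD1P[_ cS] /setD1P[_ c'S]].
  by apply/eqP; rewrite -eqSS -Sk (cardsD1 b S) bS.
exact: Sr.
Qed.


(** The bijection behind the recursion: a set with a point over [y] is a set avoiding [y] with that
    one point added. *)
Definition split_tgt (x : btgt D) : gprod Y (gpow B) :=
  match x with
  | inl t => val t
  | inr z => ((val (val z).2).1, ((val z).1 |: (val (val z).2).2)%SET)
  end.

Definition split_src (x : bsrc D) : bsrc f :=
  match x with
  | inl z => (val z).2
  | inr (inl z) => (val z).1
  | inr (inr z) => (val (val z).1).2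
  end.

Fact split_tgtP x : allsec_pred k.+1 (split_tgt x).
Proof.
case: x => [[[y S] h]|[[b [[y S] h]] /= /eqP bz]]; first exact: avoid_allsec.
exact: allsecU1.
Qed.

Fact split_tgtJ x g : split_tgt (x *^ g) = split_tgt x *^ g.
Proof. by case: x => [//|z]; congr pair; rewrite /= gpowU1. Qed.

Fact split_srcJ x g : split_src (x *^ g) = split_src x *^ g.
Proof. by case: x => [z|[z|z]]. Qed.

(** Whether the set has a point over [y] determines the summand; that point is unique, so it and the
    remaining set can be recovered. *)
Lemma split_tgt_inj : injective split_tgt.
Proof.
case=> [[[y S] h]|[[b [[y S] h]] /= bz]] [[[y' S'] h']|[[b' [[y' S'] h']] /= b'z]] //=.
- by move=> eqz; congr inl; apply: val_inj.
- case=> yy' SS'; exfalso; case/andP: (h) => _ /forall_inP /= /(_ b').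
  by rewrite SS' setU11 (eqP b'z) /= yy' eqxx => /(_ isT).
- case=> yy' SS'; exfalso; case/andP: (h') => _ /forall_inP /= /(_ b).
  by rewrite -SS' setU11 (eqP bz) /= yy' eqxx => /(_ isT).
- case=> yy' SS'; have bS := avoid_notin h (eqP bz).
  have b'S := avoid_notin h' (eqP b'z).
  have bb' : b = b'.
    have : b \in (b' |: S')%SET by rewrite -SS' setU11.
    case/setU1P => // bS'; case/andP: (h') => _ /forall_inP /= /(_ b bS').
    by rewrite (eqP bz) /= yy' eqxx.
  congr inr; apply: val_inj; congr pair => //=; apply: val_inj => /=.
  by rewrite yy' -(setU1K bS) SS' bb' setU1K.
Qed.

Lemma split_tgt_surj y (S : {set B}) : allsec_pred k.+1 (y, S) ->
  exists x, split_tgt x = (y, S).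
Proof.
move=> yS; case: (pickP (fun b => (b \in S) && (bright f b == y))) => [b|nb].
  case/andP=> bS /eqP bz; have h := avoidD1 yS bS bz.
  have bz' : bright f b == bright F (bpow_t (@avoid_predJ k) h) by exact/eqP.
  exists (inr (exist (fun z : gprod (btgt f) (btgt F) =>
    bright f z.1 == bright F z.2) (b, bpow_t (@avoid_predJ k) h) bz')) => /=.
  by rewrite setD1K.
have h : avoid_pred k.+1 (y, S).
  apply/andP; split=> //; apply/forall_inP => b bS /=.
  by have := nb b; rewrite bS /= => ->.
by exists (inl (bpow_t (@avoid_predJ k.+1) h)).
Qed.

Lemma besym_split : bispan_iso D E.
Proof.
pose v x := bpow_t (@allsec_predJ k.+1)
  (etrans (congr1 (@allsec_pred k.+1) (esym (surjective_pairing _))) (split_tgtP x)).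
have vE x : val (v x) = split_tgt x by rewrite /= -surjective_pairing.
have vJ x g : v (x *^ g) = v x *^ g.
  by apply: val_inj; rewrite vE split_tgtJ -vE.
have uP x : bpow_in (v (bmid D x), split_src x).
  rewrite /bpow_in /=; case: x => [z|[z|z]] /=; first exact: (valP z).
    exact: setU11.
  by apply/setU1P; right; exact: (valP (val z).1).
pose u x : bsrc E := bpow_s (uP x).
have uJ x g : u (x *^ g) = u x *^ g.
  by apply: val_inj; congr pair; rewrite ?split_srcJ // gmapJ vJ.
have v_inj : injective v.
  by move=> x x' /(congr1 val); rewrite !vE => /split_tgt_inj.
(* The two halves of the source of the product do not collide: by [noF], [bmid f a] cannot lie over
   [y] and belong to a set avoiding [y]. *)
have mid_inj x x' : bmid D x = bmid D x' -> split_src x = split_src x' -> x = x'.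
  have noF (a : bsrc f) (t : btgt F) : bmid f a \in (val t).2 ->
      bright f (bmid f a) = bright F t -> False.
    case: t => -[y S] h /= aS az; have := avoid_notin h az.
    by rewrite aS.
  case: x x' => [z|[z|z]] [z'|[z'|z']] //=.
  - move=> [mz] sz; congr inl; apply: val_inj.
    by apply: (eq_trans (surjective_pairing _)); rewrite mz sz -surjective_pairing.
  - move=> [_ mz] sz; congr (inr (inl _)); apply: val_inj.
    by apply: (eq_trans (surjective_pairing _)); rewrite mz sz -surjective_pairing.
  - move=> [mz mt] sz; exfalso; apply: (noF (val (val z').1).2 (val (val z').1).1).
      exact: (valP (val z').1).
    by rewrite -sz mz; exact: esym (eqP (valP z')).
  - move=> [mz mt] sz; exfalso; apply: (noF (val (val z).1).2 (val (val z).1).1).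
      exact: (valP (val z).1).
    by rewrite sz -mz; exact: esym (eqP (valP z)).
  - move=> [mz mt] sz; congr (inr (inr _)); apply: val_inj.
    apply: (eq_trans (surjective_pairing _)); rewrite [RHS]surjective_pairing mz.
    congr pair; apply: val_inj.
    by apply: (eq_trans (surjective_pairing _)); rewrite mt sz -surjective_pairing.
apply: (@bispan_isoI _ _ _ D E (GMap uJ) (GMap vJ)) => //=.
- move=> x x' /(congr1 val)[/= y_eq S_eq]; apply: mid_inj; apply: split_tgt_inj.
  by rewrite [LHS]surjective_pairing [RHS]surjective_pairing y_eq S_eq.
- case=> -[[[y S] h] a] aS; have [x xE] := split_tgt_surj h.
  suff [x' [x'm x's]] : exists x', split_tgt (bmid D x') = (y, S) /\ split_src x' = a.
    exists x'; apply: val_inj; congr pair => //; apply: val_inj.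
    by rewrite vE x'm.
  case: x xE => [t|[[b t] bt]] /= tE.
    have ta : bpow_in (t, a) by move: aS; rewrite /bpow_in /= tE.
    by exists (inl (bpow_s ta)).
  have : bmid f a \in (b |: (val t).2)%SET.
    by have := aS; rewrite /bpow_in /=; case: tE => _ ->.
  case/setU1P=> [ab|at'].
    have at_ : bright f (bmid f a) == bright F t by rewrite ab.
    exists (inr (inl (exist (fun z : gprod (bsrc f) (btgt F) =>
      bright f (bmid f z.1) == bright F z.2) (a, t) at_))) => /=.
    by rewrite ab.
  have ta : bpow_in (t, a) by [].
  have tb : bright F (bmid F (bpow_s ta)) == bright f b by rewrite eq_sym.
  by exists (inr (inr (exist (fun z : gprod (bsrc F) (btgt f) =>
    bright F (bmid F z.1) == bright f z.2) (bpow_s ta, b) tb))).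
- case=> -[y S] h; have [x xE] := split_tgt_surj h; exists x.
  by apply: val_inj; rewrite vE xE.
- by case=> [z|[z|z]].
- by case=> [t|z] //=; exact/esym/eqP/(valP z).
Qed.

End Split.
End Partial.
End Pow.

(** * Finiteness *)

Lemma finite_map_mspan (R S : comPzRingType) (f : R -> S) : finite_map f ->
  exists s, forall y, mspan (image_of f) s y.
Proof.
move=> [n [a aP]]; exists (codom a) => y; have [c ->] := aP y.
have st := mspan_stable (image_of f) (codom a).
apply: (stable_sum _ st) => k _; case: st => _ _; apply; first by exists (c k).
by apply: mspan_mem; exact: codom_f.
Qed.

Section FiniteAlgebra.
Variables (R S : comPzRingType) (f : {rmorphism R -> S}).

Lemma mspan_sum (s : seq S) x : mspan (image_of f) s x ->
  exists c : 'I_(size s) -> R, x = \sum_(k < size s) f (c k) * s`_k.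
Proof.
move=> sx; apply: (sx (fun x => exists c : 'I_(size s) -> R,
  x = \sum_(k < size s) f (c k) * s`_k)).
  split=> [|_ _ [c ->] [c' ->]|_ _ [r ->] [c ->]].
  - by exists (fun=> 0); rewrite big1 // => k _; rewrite rmorph0 mul0r.
  - exists (fun k => c k - c' k); rewrite -sumrB; apply: eq_bigr => k _.
    by rewrite rmorphB mulrBl.
  - exists (fun k => r * c k); rewrite mulr_sumr; apply: eq_bigr => k _.
    by rewrite rmorphM mulrA.
move=> y ys; have yi : (index y s < size s)%N by rewrite index_mem.
exists (fun k => (k == Ordinal yi)%:R).
rewrite (bigD1 (Ordinal yi)) //= eqxx rmorph1 mul1r nth_index // big1 ?addr0 //.
by move=> k /negPf->; rewrite rmorph0 mul0r.
Qed.

Lemma mspan_finite_map (s : seq S) :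
  (forall y, mspan (image_of f) s y) -> finite_map f.
Proof.
by move=> sP; exists (size s), (fun k : 'I_(size s) => s`_k) => y; apply: mspan_sum.
Qed.

End FiniteAlgebra.

Lemma finitely_generatedP (R : comPzRingType) :
  finitely_generated R <-> exists s : seq R, forall P : R -> Prop,
    is_subring P -> (forall y, y \in s -> P y) -> forall x, P x.
Proof.
split=> [[n [a aP]]|[s sP]].
  exists (codom a) => P Psub Pa; apply: aP => // k; apply: Pa; exact: codom_f.
exists (size s), (fun k : 'I_(size s) => s`_k) => P Psub Ps; apply: sP => // y ys.
have yi : (index y s < size s)%N by rewrite index_mem.
by have := Ps (Ordinal yi); rewrite /= nth_index.
Qed.

(** * Integral elements and finite maps *)

Section Integral.
Variable S : comPzRingType.
Implicit Types (Q : S -> Prop) (s : seq S).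

Definition integral Q x : Prop :=
  exists n, mspan Q [seq x ^+ k | k <- iota 0 n] (x ^+ n).

(** Multiplication by [x] is linear, so it is controlled by its values on generators. *)
Lemma mspan_mul Q s s' x y : (forall z, z \in s -> mspan Q s' (x * z)) ->
  mspan Q s y -> mspan Q s' (x * y).
Proof.
have [s0 sB sM] := mspan_stable Q s'.
move=> xs sy; apply: (sy (fun y => mspan Q s' (x * y))) => //.
split=> [|y1 y2|q y1]; first by rewrite mulr0.
- by rewrite mulrBr; exact: sB.
- by rewrite mulrCA; exact: sM.
Qed.

(* If F k and F k.+1 + x F k = E k are the elementary symmetric functions of the
   roots other than x and of all roots, then eliminating F exhibits x as a root
   of a monic polynomial with coefficients E k. *)
Lemma integral_telescope Q x (F E : nat -> S) n :
  F 0%N = 1 -> F n = 0 -> (forall k, Q (E k)) ->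
  (forall k, F k.+1 + x * F k = E k) -> integral Q x.
Proof.
move=> F0 Fn QE FE; exists n; pose V k := mspan Q [seq x ^+ j | j <- iota 0 k].
have V_stable k : stable Q (V k) by exact: mspan_stable.
have V_pow k j : (j < k)%N -> V k (x ^+ j).
  by move=> ltjk; apply: mspan_mem; apply: map_f; rewrite mem_iota.
have V_x k y : V k y -> V k.+1 (x * y).
  move=> Vy; apply: (mspan_mul _ Vy) => _ /mapP[j + ->]; rewrite mem_iota => ltjk.
  by rewrite -exprS; exact: V_pow.
(* The recursion in solved form: [F k] is [(- x) ^+ k] up to lower powers of [x]. For [k = n] the
   left term vanishes, which yields the monic equation. *)
have VF k : V k (F k - (- x) ^+ k).
  elim: k => [|k IH]; first by rewrite F0 subrr; case: (V_stable 0%N).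
  have -> : F k.+1 - (- x) ^+ k.+1 = E k * 1 - x * (F k - (- x) ^+ k).
    rewrite -FE mulr1 exprS mulNr opprK mulrBr opprB.
    by rewrite [X in _ = _ + X]addrC addrA addrK.
  have [_ VB VM] := V_stable k.+1; apply: VB; last exact: V_x.
  by apply: VM => //; rewrite -(expr0 x); exact: V_pow.
have := stableN (V_stable n) (VF n); rewrite Fn sub0r opprK exprNn.
rewrite -signr_odd mulr_sign; case: odd => // Vn.
by rewrite -[x ^+ n]opprK; exact: stableN (V_stable n) _.
Qed.

(** One element is adjoined at a time: the old generators are multiplied by the powers of [b] up to
    the degree [n] of its equation. *)
Lemma integral_mspan Q (bs : seq S) : (forall b, b \in bs -> integral Q b) ->
  exists s, mspan Q s 1 /\
    forall b y, b \in bs -> mspan Q s y -> mspan Q s (b * y).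
Proof.
elim: bs => [|b bs IH] bsP.
  by exists [:: 1]; split=> //; apply: mspan_mem; rewrite inE.
have [|s [s1 sM]] := IH; first by move=> c cs; apply: bsP; rewrite inE cs orbT.
have [|n bn] := bsP b; first exact: mem_head.
pose s' := [seq b ^+ k * y | k <- iota 0 n.+1, y <- s].
have s'M k y : (k <= n)%N -> mspan Q s y -> mspan Q s' (b ^+ k * y).
  move=> le_kn; apply: mspan_mul => z zs; apply: mspan_mem.
  by apply: allpairs_f; rewrite // mem_iota.
exists s'; split=> [|c y]; first by rewrite -[1]mulr1 -(expr0 b); exact: s'M.
rewrite inE => /predU1P[->|cs] s'y;
  apply: (mspan_mul _ s'y) => _ /allpairsP[[k z] /= [+ zs ->]];
  rewrite -/(iota 0 n.+1) mem_iota ltnS => /= le_kn; last first.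
  by rewrite mulrCA; apply: s'M => //; apply: sM => //; exact: mspan_mem.
have sz : mspan Q s z by exact: mspan_mem.
rewrite mulrA -exprS; move: le_kn; rewrite leq_eqVlt => /predU1P[->|]; last first.
  by move=> lt_kn; exact: s'M.
(* Only the top exponent leaves the range; replacing the factor [b ^+ n] by lower powers brings the
   exponent back to at most [n]. *)
have -> : b ^+ n.+1 * z = b * z * b ^+ n by rewrite exprS mulrAC.
apply: (mspan_mul _ bn) => _ /mapP[j + ->]; rewrite mem_iota => ltjn.
by rewrite mulrAC -exprS; exact: s'M.
Qed.

End Integral.

(** The elements multiplying the span of [s] into itself form a subring containing [bs], hence are
    all of [S]; since 1 is in the span, so is everything. *)
Lemma finite_map_integral (R S : comPzRingType) (f : {rmorphism R -> S})
    (bs : seq S) :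
  (forall b, b \in bs -> integral (image_of f) b) ->
  (forall P : S -> Prop, is_subring P -> (forall b, b \in bs -> P b) ->
     forall x, P x) ->
  finite_map f.
Proof.
move=> bsP bs_gen; have [s [s1 sM]] := integral_mspan bsP.
have [_ sB _] := mspan_stable (image_of f) s.
apply: (mspan_finite_map (s := s)) => x; rewrite -[x]mulr1.
apply: (bs_gen (fun x => forall y, mspan (image_of f) s y ->
                                   mspan (image_of f) s (x * y))) => //.
  split=> [y|x1 x2 x1P x2P y sy|x1 x2 x1P x2P y sy].
  - by rewrite mul1r.
  - by rewrite mulrBl; apply: sB; [exact: x1P | exact: x2P].
  - by rewrite -mulrA; apply: x1P; exact: x2P.
by move=> b bbs y; exact: sM.
Qed.

(** * Relative finiteness of A[X] *)

Section FreeTambara.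
Variables (gT : finGroupType) (X : gset gT) (A : tambara gT).
Variable eta : forall Y : gset gT, bispan X Y -> A Y.
Hypothesis etaP : free_tambara eta.

(** [E] is shifted by one because [F k.+1] pairs with the symmetric function of degree [k.+1]; [n]
    exceeds the number of points of [btgt f], which forces [F n = 0]. *)
Lemma eta_integral Y Z (f : bispan X Y) (p : gmap Y Z) :
  integral (image_of (@tres _ A _ _ p)) (eta f).
Proof.
have [gc etaC] := etaP.
apply: (integral_telescope (F := fun k => eta (besym_other f p k))
  (E := fun k => tres p (eta (besym f p k.+1))) (n := #|btgt f|.+1)).
- by rewrite -(gc_iso (gc Y) (besym_other0 f p)) (gc_one (gc Y)).
- by rewrite -(gc_iso (gc Y) (besym_other_big p (ltnSn _))) (gc_zero (gc Y)).
- by move=> k; exists (eta (besym f p k.+1)).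
- move=> k; rewrite /tres -etaC -(gc_iso (gc Y) (besym_resP f p k.+1)).
  rewrite -(gc_iso (gc Y) (besym_split f p k)) (gc_add (gc Y)).
  by rewrite (gc_mul (gc Y)).
Qed.

Lemma free_tambara_finitely_generated (L : {group gT}) :
  tambara_finite gT -> finitely_generated (A (gorb L)).
Proof. by move=> fin; apply: fin; exact: (etaP.1 (gorb L)). Qed.

Lemma free_tambara_finite : tambara_finite gT -> relatively_finite_dimensional A.
Proof.
move=> fin H K sHK.
have [s sP] := (finitely_generatedP _).1 (free_tambara_finitely_generated H fin).
have /choice[d dP] : forall x : A (gorb H), exists fe : bispan X (gorb H) * bispan X (gorb H),
    x = eta fe.1 - eta fe.2.
  by move=> x; have [f [f' ->]] := gc_diff (etaP.1 (gorb H)) x; exists (f, f').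
(* Integrality is known for classes of bispans, so each ring generator is replaced by the two
   classes whose difference it is. *)
pose bs := [seq eta (d x).1 | x <- s] ++ [seq eta (d x).2 | x <- s].
apply: (@finite_map_integral _ _ (tres (gproj sHK)) bs).
  by move=> b; rewrite mem_cat => /orP[] /mapP[x _ ->]; exact: eta_integral.
move=> P Psub Pbs; apply: sP => // x xs; case: (Psub) => _ PB _.
by rewrite (dP x); apply: PB; apply: Pbs; rewrite mem_cat map_f ?orbT.
Qed.

End FreeTambara.

(** * Finiteness of box products *)

Section Main.
Variables (gT : finGroupType) (T U S : tambara gT).
Variables (i : tambara_hom T S) (j : tambara_hom U S).
Hypotheses (box : box_product i j) (finT : relatively_finite_dimensional T)
  (finU : relatively_finite_dimensional U).

Let Q Y (q : S Y) := image_of (i Y) q \/ image_of (j Y) q.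

Lemma ttr_span (L H : {group gT}) (sHL : H \subset L) :
  exists s, forall t u, mspan (@Q _) s (ttr (gproj sHL) (i _ t * j _ u)).
Proof.
have [st stP] := finite_map_mspan (finT sHL).
have [su suP] := finite_map_mspan (finU sHL).
pose s := [seq ttr (gproj sHL) (i _ t * j _ u) | t <- st, u <- su].
exists s; have [s0 sB sM] := mspan_stable (@Q _) s.
(* With [u] fixed, [t] is reduced to the generators [st], then [u] to [su]: Frobenius reciprocity
   moves restricted coefficients out of the transfer, where they are multipliers in [Q]. *)
move=> t u; apply: (stP t (fun t => mspan _ s (ttr _ (i _ t * j _ u)))).
  split=> [|{}t t'|_ {}t [c ->]].
  - by rewrite rmorph0 mul0r raddf0.
  - by rewrite rmorphB mulrBl raddfB; exact: sB.
  - rewrite thM th_tres -mulrA -frobenius; apply: sM.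
    by left; exists c.
move=> {}t t_st; apply: (suP u (fun u => mspan _ s (ttr _ (i _ t * j _ u)))).
  split=> [|{}u u'|_ {}u [c ->]].
  - by rewrite rmorph0 mulr0 raddf0.
  - by rewrite rmorphB mulrBr raddfB; exact: sB.
  - rewrite thM th_tres mulrCA -frobenius; apply: sM.
    by right; exists c.
by move=> {}u u_su; apply: mspan_mem; exact: allpairs_f.
Qed.

(** [ttr_orbits] cuts the arbitrary [W] of [box_gen] into orbits, so only the finitely many
    subgroups [H] of [L] contribute generators. *)
Lemma box_span (L : {group gT}) : exists s, forall y : S (gorb L), mspan (@Q _) s y.
Proof.
have /choice[s sP] : forall H : {group gT}, exists s, forall (sHL : H \subset L) t u,
    mspan (@Q _) s (ttr (gproj sHL) (i _ t * j _ u)).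
  (* For [H] not contained in [L] the condition is vacuous and the list is empty. *)
  move=> H; have [sHL|nsHL] := pselect (H \subset L); last by exists [::].
  have [s sP] := ttr_span sHL; exists s => sHL'.
  by rewrite (_ : sHL' = sHL) //; exact: bool_irrelevance.
exists (flatten [seq s H | H <- enum {: {group gT}}]) => y.
have st := mspan_stable (@Q _) (flatten [seq s H | H <- enum {: {group gT}}]).
have [W [f [t [u ->]]]] := box_gen box y.
apply: (ttr_orbits (P := fun Y (y : S Y) => exists t u, y = i Y t * j Y u)).
- by move=> Y Z g _ [t' [u' ->]]; exists (tres g t'), (tres g u'); rewrite tresM !th_tres.
- by case: st.
- by move=> x z; exact: stableD st.
- move=> H sHL _ [t' [u' ->]]; apply: mspanS (sP H sHL t' u') => // z zs.
  by apply/flatten_mapP; exists H; rewrite // mem_enum.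
- by exists t, u.
Qed.

(** The generators are products of generators of T and U over the restriction with the list [s]
    spanning [S] at [H]. Quantifying [all_span] over [t] and [u] lets multipliers from T and U at
    [H] be absorbed into them. *)
Lemma box_relatively_finite : relatively_finite_dimensional S.
Proof.
move=> H K sHK; have [st stP] := finite_map_mspan (finT sHK).
have [su suP] := finite_map_mspan (finU sHK).
have [s sP] := box_span H.
pose s1 := [seq i _ t * j _ u | t <- st, u <- su].
pose s2 := [seq x * w | x <- s1, w <- s]; apply: (@mspan_finite_map _ _ (tres (gproj sHK)) s2).
have [r0 rB rM] := mspan_stable (image_of (@tres _ S _ _ (gproj sHK))) s2.
set span := mspan _ s2 in r0 rB rM *.
suff all_span y t u : span (i _ t * j _ u * y).
  by move=> y; have := all_span y 1 1; rewrite !rmorph1 !mul1r.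
move: t u; apply: (sP y (fun y => forall t u, span (i _ t * j _ u * y))).
  split=> [t u|x z xP zP t u|q x [] [c ->] xP t u].
  - by rewrite mulr0.
  - by rewrite mulrBr; apply: rB; [exact: xP | exact: zP].
  - by have := xP (t * c) u; rewrite rmorphM mulrA [_ * _ * j _ u]mulrAC.
  - by have := xP t (u * c); rewrite rmorphM !mulrA.
move=> w ws t u; apply: (stP t (fun t => span (i _ t * j _ u * w))).
  split=> [|{}t t'|_ {}t [c ->]].
  - by rewrite rmorph0 !mul0r.
  - by rewrite rmorphB !mulrBl; exact: rB.
  - move=> sw; rewrite thM th_tres -[_ * _ * j _ u]mulrA -mulrA.
    by apply: rM sw; exists (i _ c).
move=> {}t t_st; apply: (suP u (fun u => span (i _ t * j _ u * w))).
  split=> [|{}u u'|_ {}u [c ->]].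
  - by rewrite rmorph0 mulr0 mul0r.
  - by rewrite rmorphB mulrBr mulrBl; exact: rB.
  - by move=> sw; rewrite thM th_tres mulrCA -mulrA; apply: rM sw; exists (j _ c).
by move=> {}u u_su; apply: mspan_mem; apply: allpairs_f => //; exact: allpairs_f.
Qed.

(** The span of [s] over the image of T is Noetherian; the images of the generators of U are then
    adjoined one by one by [noeth_polyspan]. The resulting module contains [s] and is stable under
    both images, so it is everything. *)
Lemma box_noetherian (L : {group gT}) : noetherian (T (gorb L)) ->
  finitely_generated (U (gorb L)) -> noetherian (S (gorb L)).
Proof.
move=> noethT /finitely_generatedP[g gP]; have [s sP] := box_span L.
pose QT l (q : S (gorb L)) := image_of (i _) q \/ q \in [seq j _ x | x <- l].
have step (l : seq (U (gorb L))) : exists M : S (gorb L) -> Prop,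
    [/\ stable (QT l) M, noeth (QT l) M & forall y, y \in s -> M y].
  elim: l => [|x l [M [Mst nM sM]]].
    have QTE q : QT [::] q -> image_of (i _) q by case.
    exists (mspan (image_of (i _)) s); split.
    - exact: stableS QTE (mspan_stable _ _).
    - move=> N Nst sN; have [|t [tN gN]] := noeth_mspan noethT (s := s) _ sN.
        by apply: stableS Nst => q; left.
      by exists t; split=> // y /gN; apply: mspanS => // q; left.
    - by move=> y; exact: mspan_mem.
  have QTE q : QT (x :: l) q <-> QT l q \/ q = j _ x.
    rewrite /QT /=; split=> [[qi|]|[[qi|ql]|->]].
    + by left; left.
    + by rewrite inE => /predU1P[->|ql]; [right | left; right].
    + by left.
    + by right; rewrite inE ql orbT.
    + by right; rewrite inE eqxx.
  exists (polyspan M (j _ x)); split.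
  - by apply: stableS (polyspan_stable (j _ x) Mst) => q /QTE.
  - move=> N Nst sN; have [|t [tN gN]] := noeth_polyspan Mst nM (x := j _ x) _ sN.
      by apply: stableS Nst => q /QTE.
    by exists t; split=> // y /gN; apply: mspanS => // q /QTE.
  - by move=> y /sM; exact: polyspan_base.
have [M [Mst nM sM]] := step g.
(* [M] is so far stable only under the images of the generators [g]; the elements of U that preserve
   it form a subring. *)
have jM u y : M y -> M (j _ u * y).
  move: u y; apply: gP.
    have [_ MB _] := Mst; split=> [y|u u' uP u'P y My|u u' uP u'P y My].
    - by rewrite rmorph1 mul1r.
    - by rewrite rmorphB mulrBl; apply: MB; [exact: uP | exact: u'P].
    - by rewrite rmorphM -mulrA; apply: uP; exact: u'P.
  move=> u ug y My; case: Mst => _ _; apply=> //.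
  by right; exact: map_f.
have allM y : M y.
  apply: (sP y M) => //; have [M0 MB MM] := Mst; split=> // _ x [[c ->]|[c ->]] Mx.
    by apply: MM => //; left; exists c.
  exact: jM.
move=> I [I0 ID IM].
have Ist (Q' : S (gorb L) -> Prop) : stable Q' I.
  by split=> [//|x y Ix Iy|q x _]; [rewrite -mulN1r; apply: ID => //; exact: IM | exact: IM].
have [//|t [tI gI]] := nM I (Ist _).
exists (size t), (fun k : 'I_(size t) => t`_k); split=> [k|x Ix].
  by apply: tI; exact: mem_nth.
(* The ring acts on itself, so arbitrary ring elements serve as coefficients. *)
apply: (@mspan_sum _ _ idfun t x).
by apply: mspanS (gI x Ix) => // q _; exists q.
Qed.

(** A subring containing the images of generators of T and U contains both images, hence is a module
    over [Q]; containing [s] too, it is everything. *)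
Lemma box_finitely_generated (L : {group gT}) : finitely_generated (T (gorb L)) ->
  finitely_generated (U (gorb L)) -> finitely_generated (S (gorb L)).
Proof.
move=> /finitely_generatedP[gT' gTP] /finitely_generatedP[gU gUP].
have [s sP] := box_span L.
apply/finitely_generatedP.
exists ([seq i _ x | x <- gT'] ++ [seq j _ x | x <- gU] ++ s) => P [P1 PB PM] Ps.
have Pi t : P (i _ t).
  move: t; apply: gTP => [|t tg]; last by apply: Ps; rewrite mem_cat map_f.
  split=> [|t t' Pt Pt'|t t' Pt Pt']; first by rewrite rmorph1.
    by rewrite rmorphB; exact: PB.
  by rewrite rmorphM; exact: PM.
have Pj u : P (j _ u).
  move: u; apply: gUP => [|u ug]; last by apply: Ps; rewrite !mem_cat map_f ?orbT.
  split=> [|t t' Pt Pt'|t t' Pt Pt']; first by rewrite rmorph1.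
    by rewrite rmorphB; exact: PB.
  by rewrite rmorphM; exact: PM.
move=> x; apply: (sP x P) => [|y ys]; last by apply: Ps; rewrite !mem_cat ys !orbT.
split=> [|//|_ y [[c ->]|[c ->]] Py]; first by rewrite -(subrr 1); exact: PB.
  by apply: PM.
by apply: PM.
Qed.

End Main.

Theorem theoremC (gT : finGroupType) (X : gset gT) (T AX TX : tambara gT)
    (eta : forall Y : gset gT, bispan X Y -> AX Y)
    (i : tambara_hom T TX) (j : tambara_hom AX TX) :
  tambara_finite gT ->
  free_tambara eta ->
  box_product i j ->
  levelwise_noetherian T ->
  relatively_finite_dimensional T ->
  (levelwise_noetherian TX /\ relatively_finite_dimensional TX) /\
  (levelwise_finitely_generated T -> levelwise_finitely_generated TX).
Proof.
move=> fin free box noethT finT.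
have fgA L := free_tambara_finitely_generated free L fin.
have finA := free_tambara_finite free fin.
split; first split.
- by move=> L; exact: (box_noetherian box finT finA (noethT L) (fgA L)).
- exact: (box_relatively_finite box finT finA).
- by move=> fgT L; exact: (box_finitely_generated box finT finA (fgT L) (fgA L)).
Qed.
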